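(* Let $0=t_0<t_1<\dots<t_N=\tau$, let $h:=\max\{t_{\ell+1}-t_\ell:\ell=0,\dots,N-1\}$, and let $x\in\mathrm{H}^1([0,\tau];\mathbb{R}^n)$. Suppose that there are constants $M\in[0,\pi/h)$ and $c\ge0$ such that $\|x'\|_{\mathrm{L}^2}\le M\|x\|_{\mathrm{L}^2}+c$. Let $\overline\delta=[\overline\delta_1\ \cdots\ \overline\delta_n]^\top$ with $\overline\delta_i>0$, and let $\delta_\ell=[\delta_{\ell,1}\ \cdots\ \delta_{\ell,n}]^\top\in\mathbb{R}^n$ satisfy $|\delta_{\ell,i}|\le\overline\delta_i$ for all $\ell=0,\dots,N$ and $i=1,\dots,n$. Let $\overline x\in\mathrm{H}^1([0,\tau];\mathbb{R}^n)$ be the piecewise linear interpolant of the noisy samples, $$\overline x(t)=\frac{t_{\ell+1}-t}{t_{\ell+1}-t_\ell}(x(t_\ell)+\delta_\ell)+\frac{t-t_\ell}{t_{\ell+1}-t_\ell}(x(t_{\ell+1})+\delta_{\ell+1}),\quad t_\ell\le t<t_{\ell+1},\ \ell=0,\dots,N-1$$ (extended continuously to $t=\tau$). Let $\sigma>0$ and $v\in\mathrm{L}^2([0,\tau];\mathbb{R}^n)$ satisfy $VV^*\preceq\sigma^2I_n$, where $V$ is the synthesis operator associated with $v$. Then the synthesis operators $\overline P$ and $\overline Q$ associated with $x'-\overline x'+v$ and $x-\overline x$, respectively, satisfy $$\overline P\,\overline P^*\preceq\left(\frac{h(M\|\overline x\|_{\mathrm{L}^2}+c)}{\pi-hM}+\frac{\pi\sqrt\tau\,\|\overline\delta\|_{\mathbb{R}^n}}{\pi-hM}+\sigma\right)^2I_n,$$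 $$\overline Q\,\overline Q^*\preceq\frac{\tau^2}{\pi^2}\left(\frac{h(M\|\overline x\|_{\mathrm{L}^2}+c)}{\pi-hM}+\frac{\pi\sqrt\tau\,\|\overline\delta\|_{\mathbb{R}^n}}{\pi-hM}\right)^2I_n.$$
   Context: $n$ and $N$ are positive integers, $\tau>0$. $\mathrm{H}^1([0,\tau];\mathbb{R}^n)$ is the space of absolutely continuous functions $\phi:[0,\tau]\to\mathbb{R}^n$ with $\phi'\in\mathrm{L}^2([0,\tau];\mathbb{R}^n)$; $\|\cdot\|_{\mathrm{L}^2}$ is the norm of $\mathrm{L}^2([0,\tau];\mathbb{R}^n)$ and $\|\cdot\|_{\mathbb{R}^n}$ the Euclidean norm. $\mathrm{H}^1_0[0,\tau]$ is the space of real-valued $\phi\in\mathrm{H}^1([0,\tau];\mathbb{R})$ with $\phi(0)=\phi(\tau)=0$, a Hilbert space with inner product $\langle\phi,\psi\rangle=\int_0^\tau\phi'(t)\psi'(t)\,dt$. The synthesis operator associated with $f\in\mathrm{L}^2([0,\tau];\mathbb{R}^n)$ is the bounded linear operator $F:\mathrm{H}^1_0[0,\tau]\to\mathbb{R}^n$, $F\phi=\int_0^\tau\phi(t)f(t)\,dt$; $F^*$ is its Hilbert space adjoint and $FF^*$ is identified with an $n\times n$ matrix. For symmetric matrices, $A\preceq B$ means $B-A$ is nonnegative definite. *)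

(* Defs.v *)
From HB Require Import structures.
From mathcomp Require Import all_boot all_order all_algebra.
From mathcomp Require Import all_classical all_reals all_analysis.

Set Implicit Arguments.
Unset Strict Implicit.
Unset Printing Implicit Defensive.

Import Order.TTheory GRing.Theory Num.Theory.
Import numFieldNormedType.Exports.

Local Open Scope classical_set_scope.
Local Open Scope ring_scope.

(* A function on [0, tau] is represented by a function on R of which only the
   values on [0, tau] matter.  In particular derive1 f is the derivative of f
   at the interior points of [0, tau] where f is differentiable; its values at
   the other points of [0, tau], a null set for an absolutely continuous f, are
   irrelevant. *)

Definition edot (R : realType) (n : nat) (x y : 'cV[R]_n) : R :=
  \sum_(i < n) x i 0 * y i 0.

(* Not the library norm `|x| on 'cV[R]_n, which is the sup norm. *)
Definition enorm (R : realType) (n : nat) (x : 'cV[R]_n) : R :=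
  Num.sqrt (edot x x).

(* For V = 'cV[R]_n the norm below is the sup norm; as all norms on R^n are
   equivalent, this is absolute continuity for the Euclidean norm as well. *)
Definition abs_cont (R : realType) (V : normedModType R) (tau : R)
    (f : R -> V) : Prop :=
  forall eps : R, 0 < eps -> exists2 del : R, 0 < del &
    forall (m : nat) (a b : 'I_m -> R),
      (forall i, [/\ 0 <= a i, a i <= b i & b i <= tau]) ->
      trivIset setT (fun i => `]a i, b i[%classic) ->
      \sum_(i < m) (b i - a i) < del ->
      \sum_(i < m) `|f (b i) - f (a i)| < eps.

(* The restriction "\_" extends a function by 0 outside [0, tau]. *)
Definition L2 (R : realType) (tau : R) (f : R -> R) : Prop :=
  (f \_ `[0, tau]) \in Lfun (@lebesgue_measure R) 2%:E.

Definition L2vec (R : realType) (n : nat) (tau : R) (f : R -> 'cV[R]_n) : Prop :=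
  forall i : 'I_n, L2 tau (fun t => f t i 0).

Definition L2norm (R : realType) (n : nat) (tau : R) (f : R -> 'cV[R]_n) : R :=
  fine 'N[@lebesgue_measure R]_2%:E
         [EFin \o ((fun t => enorm (f t)) \_ `[0, tau])].

Definition H1vec (R : realType) (n : nat) (tau : R) (x : R -> 'cV[R]_n) : Prop :=
  abs_cont tau x /\ L2vec tau (derive1 x).

Definition H10 (R : realType) (tau : R) (phi : R -> R) : Prop :=
  [/\ abs_cont tau (phi : R -> R^o), L2 tau (derive1 phi), phi 0 = 0 & phi tau = 0].

Definition H10_inner (R : realType) (tau : R) (phi psi : R -> R) : R :=
  \int[@lebesgue_measure R]_(t in `[0, tau]) (derive1 phi t * derive1 psi t).

Definition synthesis (R : realType) (n : nat) (tau : R) (f : R -> 'cV[R]_n)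
    (phi : R -> R) : 'cV[R]_n :=
  \col_(i < n) \int[@lebesgue_measure R]_(t in `[0, tau]) (phi t * f t i 0).

(* G is a Hilbert space adjoint of F : H10 -> R^n; this determines each G y
   on [0, tau]. *)
Definition is_adjoint (R : realType) (n : nat) (tau : R)
    (F : (R -> R) -> 'cV[R]_n) (G : 'cV[R]_n -> R -> R) : Prop :=
  forall y : 'cV[R]_n, H10 tau (G y) /\
    forall phi : R -> R, H10 tau phi ->
      edot (F phi) y = H10_inner tau phi (G y).

(* The default value is relevant only when F has no adjoint, that is, when F is
   not a bounded linear operator on H10. *)
Definition adjoint (R : realType) (n : nat) (tau : R)
    (F : (R -> R) -> 'cV[R]_n) : 'cV[R]_n -> R -> R :=
  xget (fun _ _ => 0) [set G | is_adjoint tau F G].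

(* The matrix of the linear map F F^* in the canonical basis of R^n. *)
Definition FFadj (R : realType) (n : nat) (tau : R)
    (F : (R -> R) -> 'cV[R]_n) : 'M[R]_n :=
  \matrix_(i < n, j < n) F (adjoint tau F (delta_mx j 0)) i 0.

Definition nonneg_definite (R : realType) (n : nat) (A : 'M[R]_n) : Prop :=
  A \is symmetricmx /\ forall y : 'cV[R]_n, 0 <= (y^T *m A *m y) 0 0.

Definition loewner_le (R : realType) (n : nat) (A B : 'M[R]_n) : Prop :=
  nonneg_definite (B - A).

(* Starting the maximum at 0 is harmless: it is applied to N > 0 and t
   increasing on {0, ..., N}. *)
Definition mesh (R : realType) (N : nat) (t : nat -> R) : R :=
  \big[Num.max/0]_(l < N) (t l.+1 - t l).

(* Main.v *)
(* With e = x - xbar, the operator F associated with an L^2 function f satisfies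
   y^T F F^* y = |F^* y|^2, so F F^* <= K^2 I follows from the bound
   <F phi, y> <= K |y| |phi| on H^1_0. For f = e' integration by parts gives K = |e|_{L^2};
   for f = e the Wirtinger inequality on [0, tau] gives K = (tau / pi) |e|_{L^2}.
   On each [t_l, t_{l+1}] the difference of x and its noise-free interpolant vanishes at
   both ends, and its derivative is the projection of x' orthogonal to the constants, so
   Wirtinger again gives |e| <= (h / pi) |x'| + sqrt tau |dbar|; together with
   |x'| <= M |x| + c and |x| <= |xbar| + |e| this is solved for |e|.
   The calculus rests on the fundamental theorem for absolutely continuous functions:
   such an f is the difference of the monotone absolutely continuous functions V and V - f,
   V its total variation; a monotone one defines a Stieltjes measure dominated by the Lebesgue
   measure, whose Radon-Nikodym density is f' almost everywhere by Lebesgue differentiation. *)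
From HB Require Import structures.
Require Import Defs.
From mathcomp Require Import all_boot all_order all_algebra.
From mathcomp Require Import all_classical all_reals all_analysis.
From mathcomp Require Import measurable_realfun.
From mathcomp Require Import ring lra.

Set Implicit Arguments.
Unset Strict Implicit.
Unset Printing Implicit Defensive.

Import Order.TTheory GRing.Theory Num.Theory.
Import numFieldNormedType.Exports.

Local Open Scope classical_set_scope.
Local Open Scope ring_scope.

(** * Absolutely continuous functions *)

Section AbsCont.
Context {R : realType}.
Implicit Types (f g : R -> R) (p q : R * R) (s L : seq (R * R)) (lo hi : R).

(** Two obstacles shape the development. [derive1] is meaningful only almost everywhere, so integral
    identities are stated for the relation [primitive], whose density may be changed on a null set,
    and [derive1] enters as one admissible density. And [adjoint] is a chosen value, so [FFadj]
    carries information only once some adjoint has been exhibited; this is why representers in H^1_0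
    are constructed explicitly. A bound [(A + B)^2] is not additive over subintervals and
    coordinates. It is replaced by [(1 + s) A^2 + (1 + s^-1) B^2] with one [s] common to all pieces,
    and the infimum over [s] is taken only after summation. The same device yields the
    Cauchy-Schwarz and triangle inequalities. The constant pi comes from the first Dirichlet
    eigenvalue [(pi / (b - a))^2] of [- w''] on [a, b]: subintervals of length at most [h]
    contribute [h / pi], and [0, tau] contributes [tau / pi]. *)

Definition sepitv p q := (p.2 <= q.1) || (q.2 <= p.1).

Definition subseg lo hi p := [&& lo <= p.1, p.1 <= p.2 & p.2 <= hi].

Definition subsegs lo hi s := all (subseg lo hi) s && pairwise sepitv s.

(* [abs_cont] with lists instead of families of segments: lists can be concatenated, as is
   needed to refine each segment by a partition. *)
Definition ac lo hi f := forall eps : R, 0 < eps -> exists2 del : R, 0 < del &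
  forall s, subsegs lo hi s -> \sum_(p <- s) (p.2 - p.1) < del ->
    \sum_(p <- s) `|f p.2 - f p.1| < eps.

Lemma sepitv_disjoint p q : sepitv p q -> `]p.1, p.2[ `&` `]q.1, q.2[ = set0 :> set R.
Proof.
move=> /orP[h|h]; apply/seteqP; split => // y [] /=;
  rewrite !in_itv/= => /andP[h1 h2] /andP[h3 h4]; exfalso; lra.
Qed.

(** The 1-Lipschitz map [F] is the identity for scalar functions and a coordinate for vector-valued
    ones, the sup norm dominating every coordinate. *)
Lemma abs_cont_ac (V : normedModType R) tau (F : V -> R) (f : R -> V) :
  (forall u v, `|F u - F v| <= `|u - v|) -> abs_cont tau f -> ac 0 tau (F \o f).
Proof.
move=> F1 acf e e0; have [d d0 H] := acf e e0; exists d => // s /andP[sI sD] sd.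
have -> : \sum_(p <- s) `|(F \o f) p.2 - (F \o f) p.1| =
   \sum_(i < size s) `|F (f (nth (0, 0) s i).2) - F (f (nth (0, 0) s i).1)|.
  by rewrite (big_nth (0, 0)) big_mkord.
apply: (@le_lt_trans _ _ (\sum_(i < size s) `|f (nth (0, 0) s i).2 - f (nth (0, 0) s i).1|)).
  by apply: ler_sum => i _.
apply: (H _ (fun i => (nth (0, 0) s i).1) (fun i => (nth (0, 0) s i).2)).
- by move=> i; have /all_nthP-/(_ (0,0) i (ltn_ord i))/and3P[] := sI.
- apply/trivIsetP => i j _ _ ij.
  have /(pairwiseP (0, 0)) sDij := sD.
  case: (ltngtP (i : nat) (j : nat)) => [{}ij|{}ij|/val_inj E]; last by rewrite E eqxx in ij.
    by apply: sepitv_disjoint; apply: sDij => //; rewrite inE.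
  by rewrite setIC; apply: sepitv_disjoint; apply: sDij => //; rewrite inE.
- by rewrite (big_nth (0, 0)) big_mkord in sd.
Qed.

Lemma acD lo hi f g : ac lo hi f -> ac lo hi g -> ac lo hi (f \+ g).
Proof.
move=> acf acg e e0; have e20 : 0 < e / 2 by lra.
have [d1 d10 H1] := acf _ e20; have [d2 d20 H2] := acg _ e20.
exists (Num.min d1 d2); first by rewrite lt_min d10.
move=> s sI; rewrite lt_min => /andP[sd1 sd2].
have := H1 _ sI sd1; have := H2 _ sI sd2 => h2 h1.
apply: (@le_lt_trans _ _ (\sum_(p <- s) `|f p.2 - f p.1| + \sum_(p <- s) `|g p.2 - g p.1|)); last lra.
rewrite -big_split/=; apply: ler_sum => p _.
by rewrite opprD addrACA ler_normD.
Qed.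

Lemma ac_uniformly_continuous lo hi f a b : ac lo hi f -> lo <= a -> b <= hi ->
  forall eps : R, 0 < eps -> exists2 del : R, 0 < del &
  forall x y, a <= x -> x <= y -> y <= b -> y - x < del -> `|f y - f x| < eps.
Proof.
move=> acf a0 bt e e0; have [d d0 H] := acf e e0; exists d => // x y ax xy yb xyd.
have := H [:: (x, y)]; rewrite !big_seq1/=; apply => //.
by rewrite /subsegs/= !andbT /subseg /=; lra.
Qed.

Lemma ac_continuous lo hi f : lo < hi -> ac lo hi f -> {within `[lo, hi], continuous f}.
Proof.
move=> t0 acf; apply/continuous_within_itvP => //.
have H := ac_uniformly_continuous acf (lexx lo) (lexx hi).
split.
- move=> x; rewrite in_itv/= => /andP[x0 xt].
  apply/cvgrPdist_lt => e e0; have [d d0 {}H] := H _ e0.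
  near=> y.
  have yd : `|x - y| < d by near: y; apply: cvgr_dist_lt.
  have y0 : lo < y by near: y; exact: lt_nbhsr.
  have yt : y < hi by near: y; exact: lt_nbhsl.
  case: (leP x y) => xy.
    by rewrite distrC; apply: H; try lra; rewrite distrC ger0_norm in yd; lra.
  by apply: H; try lra; rewrite ger0_norm in yd; lra.
- apply/cvgrPdist_lt => e e0; have [d d0 {}H] := H _ e0.
  near=> y.
  have y0 : lo < y by near: y; exact: nbhs_right_gt.
  have yt : y < hi by near: y; exact: nbhs_right_lt.
  have yd : y < lo + d by near: y; apply: nbhs_right_lt; lra.
  by rewrite distrC; apply: H; lra.
- apply/cvgrPdist_lt => e e0; have [d d0 {}H] := H _ e0.
  near=> y.
  have y0 : y < hi by near: y; exact: nbhs_left_lt.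
  have yt : lo < y by near: y; exact: nbhs_left_gt.
  have yd : hi - d < y by near: y; apply: nbhs_left_gt; lra.
  by apply: H; lra.
Unshelve. all: by end_near. Qed.

Lemma within_continuous_bounded a b f : a <= b -> {within `[a, b], continuous f} ->
  exists2 B, 0 < B & forall x, a <= x -> x <= b -> `|f x| <= B.
Proof.
move=> ab cf.
have cnf : {within `[a, b], continuous (fun x => `|f x|)}.
  by move=> x; apply: continuous_comp; [exact: cf|exact: norm_continuous].
have [c _ H] := EVT_max ab cnf; exists (`|f c| + 1); first by rewrite ltr_wpDl.
move=> x ax xb; rewrite (le_trans (H x _)) ?in_itv/= ?ax//; lra.
Qed.

Lemma acM lo hi f g : lo < hi -> ac lo hi f -> ac lo hi g -> ac lo hi (f \* g).
Proof.
move=> t0 acf acg.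
have [A A0 fA] := within_continuous_bounded (ltW t0) (ac_continuous t0 acf).
have [B B0 gB] := within_continuous_bounded (ltW t0) (ac_continuous t0 acg).
move=> e e0.
have [d1 d10 H1] := acf (e / 2 / B) ltac:(by rewrite !divr_gt0).
have [d2 d20 H2] := acg (e / 2 / A) ltac:(by rewrite !divr_gt0).
exists (Num.min d1 d2); first by rewrite lt_min d10.
move=> s sI; rewrite lt_min => /andP[sd1 sd2].
have := H1 _ sI sd1; have := H2 _ sI sd2; rewrite !ltr_pdivlMr// => h2 h1.
apply: (@le_lt_trans _ _ ((\sum_(p <- s) `|f p.2 - f p.1|) * B + (\sum_(p <- s) `|g p.2 - g p.1|) * A)); last lra.
rewrite !mulr_suml -big_split/= big_seq [leRHS]big_seq; apply: ler_sum => p.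
move: sI => /andP[/allP sI _] /sI /and3P[p0 p12 pt].
have -> : f p.2 * g p.2 - f p.1 * g p.1 = (f p.2 - f p.1) * g p.2 + (g p.2 - g p.1) * f p.1 by ring.
rewrite (le_trans (ler_normD _ _))// !normrM lerD//; apply: ler_wpM2l => //.
  by apply: gB; lra.
by apply: fA; lra.
Qed.

Notation steps a l := (zip (a :: l) l).

Lemma variation_steps f (a b : R) (l : seq R) : itv_partition a b l ->
  variation a b f l = \sum_(p <- steps a l) `|f p.2 - f p.1|.
Proof.
elim: l a => [|x l ih] a; first by rewrite variation_nil big_nil.
move=> abl; have xbl := itv_partition_cons abl.
rewrite /variation/= big_nat_recl//= big_cons/= -ih//.
Qed.

Lemma steps_itv (a b : R) (l : seq R) : itv_partition a b l ->
  all (fun p => [&& a <= p.1, p.1 <= p.2 & p.2 <= b]) (steps a l) /\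
  pairwise sepitv (steps a l).
Proof.
elim: l a => [//|x l ih] a abl; have xbl := itv_partition_cons abl.
have [H1 H2] := ih _ xbl; move: (abl) => [/= /andP[ax _] _].
have xb : x <= b := itv_partition_le xbl.
split=> /=.
  rewrite lexx (ltW ax) xb/=; apply: sub_all H1 => p /and3P[p1 p2 p3]; apply/and3P; split=> //; lra.
rewrite H2 andbT; apply: sub_all H1 => p /and3P[p1 p2 p3].
by rewrite /sepitv/= p1.
Qed.

Lemma steps_length (a b : R) (l : seq R) : itv_partition a b l ->
  \sum_(p <- steps a l) (p.2 - p.1) = b - a.
Proof.
elim: l a => [|x l ih] a abl; first by rewrite big_nil (itv_partition_nil abl) subrr.
by rewrite /= big_cons/= ih; [ring|exact: itv_partition_cons abl].
Qed.

(** Taking 1 for the tolerance, the variation is at most 1 on every segment shorter than [d]. By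
    additivity it remains finite after [k] steps of length [d / 2], and the Archimedean property
    provides enough steps to reach [hi]. *)
Lemma ac_bounded_variation lo hi f : lo <= hi -> ac lo hi f ->
  bounded_variation lo hi f.
Proof.
move=> t0 /(_ 1 ltr01)[d d0 H].
have small a b : lo <= a -> a <= b -> b <= hi -> b - a < d ->
    total_variation a b f \is a fin_num.
  move=> a0 ab bt abd; apply/bounded_variationP => //; exists 1 => _ [l al <-].
  have [h1 h2] := steps_itv al.
  rewrite (variation_steps _ al) ltW// H ?(steps_length al)//.
  rewrite /subsegs h2 andbT; apply: sub_all h1 => p /and3P[p1 p2 p3].
  rewrite /subseg; lra.
suff main (k : nat) (b : R) : lo <= b -> b <= hi -> b < lo + k%:R * (d / 2) ->
    total_variation lo b f \is a fin_num.
  apply/bounded_variationP => //; apply: (main (Num.bound ((hi - lo) / (d / 2)))) => //.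
  rewrite -ltrBlDl -ltr_pdivrMr; last lra.
  by apply: archi_boundP; rewrite divr_ge0//; lra.
elim: k b => [|k ih] b b0 bt; first by rewrite mul0r addr0; lra.
rewrite -natr1 => bk.
have [bd|bd] := ltP b (lo + d / 2); first by apply: small => //; lra.
rewrite (total_variationD _ (_ : lo <= b - d / 2)); [|lra|lra].
by rewrite fin_numD ih ?small//; lra.
Qed.

Lemma fine_total_variationB lo hi f x y : ac lo hi f -> lo <= x -> x <= y -> y <= hi ->
  total_variation x y f =
    (fine (total_variation lo y f) - fine (total_variation lo x f))%:E.
Proof.
move=> acf x0 xy yt; have BV : bounded_variation lo hi f.
  by apply: ac_bounded_variation => //; lra.
have fx : total_variation lo x f \is a fin_num.
  by apply/bounded_variationP => //; apply: bounded_variationl BV; lra.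
have fy : total_variation lo y f \is a fin_num.
  by apply/bounded_variationP; [lra|apply: bounded_variationl BV; lra].
rewrite EFinB !fineK// (total_variationD f x0 xy) addeAC subee// add0e//.
Qed.

(* By induction on [s]: the total variation on its first segment is a supremum over partitions,
   the steps of which are moved to [L]. *)
Lemma total_variation_sum_le lo hi f (d e : R) : ac lo hi f ->
  (forall s, subsegs lo hi s -> \sum_(p <- s) (p.2 - p.1) < d ->
    \sum_(p <- s) `|f p.2 - f p.1| < e) ->
  forall s L, subsegs lo hi (L ++ s) -> \sum_(p <- L ++ s) (p.2 - p.1) < d ->
  \sum_(p <- L) `|f p.2 - f p.1| +
  \sum_(p <- s) fine (total_variation p.1 p.2 f) <= e.
Proof.
move=> acf H; elim=> [|p s ih] L; first by rewrite cats0 big_nil addr0 => h1 h2; exact/ltW/H.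
rewrite /subsegs all_cat pairwise_cat /= => /andP[/and3P[aL ap as_]].
rewrite allrel_consr => /and3P[/andP[Lp Ls] wL /andP[ps ws]].
rewrite big_cat/= !big_cons => Ld.
move: (ap) => /and3P[p0 p12 pt].
set S1 := \sum_(p <- L) _; set S2 := \sum_(p <- s) _.
suff : (total_variation p.1 p.2 f <= (e - S1 - S2)%:E)%E.
  by rewrite (fine_total_variationB acf)// lee_fin /=; lra.
apply: ub_ereal_sup => _ [_ [l al <-] <-]; rewrite lee_fin.
have [h1 h2] := steps_itv al.
suff : \sum_(q <- L ++ steps p.1 l) `|f q.2 - f q.1| + S2 <= e.
  by rewrite big_cat/= -(variation_steps f al) -/S1; lra.
apply: ih; last first.
  by rewrite !big_cat/= (steps_length al); lra.
rewrite /subsegs !all_cat !pairwise_cat aL as_ wL ws h2 !andbT/=.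
apply/and3P; split.
- by apply: sub_all h1 => q /and3P[q1 q2 q3]; rewrite /subseg; lra.
- rewrite allrel_catl Ls/=; apply/allrelP => q r /(allP h1)/and3P[q1 q2 q3] /(allP ps).
  by rewrite /sepitv => /orP[h|h]; lra.
- apply/allrelP => r q /(allP Lp) + /(allP h1)/and3P[q1 q2 q3].
  by rewrite /sepitv => /orP[h|h]; lra.
Qed.

Lemma ac_total_variation lo hi f : ac lo hi f ->
  ac lo hi (fun t => fine (total_variation lo t f)).
Proof.
(* Suprema over partitions turn the strict bound into a large one, hence the margin [e / 2]. *)
move=> acf e e0; have [d d0 H] := acf (e / 2) ltac:(lra).
exists d => // s sI sd.
have /(_ [::]) := total_variation_sum_le acf H (s := s).
rewrite /= big_nil add0r => /(_ sI sd) h.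
apply: (@le_lt_trans _ _ (e / 2)); last lra.
apply: le_trans h; rewrite big_seq [leRHS]big_seq; apply: ler_sum => p ps.
move: sI => /andP[/allP/(_ _ ps)/and3P[p0 p12 pt] _].
have := fine_total_variationB acf p0 p12 pt => E; rewrite E/=.
rewrite ger0_norm// -lee_fin -E; exact: total_variation_ge0.
Qed.

End AbsCont.

(** * Fundamental theorem of calculus *)

Section Density.
Context {R : realType}.
Notation mu := (@lebesgue_measure R).
Implicit Types (f g : R -> R) (lo hi : R).

(** Composition with [clamp] extends a function on [lo, hi] by its end values, as a Stieltjes
    measure needs a function on the whole line. Being monotone and 1-Lipschitz, [clamp] preserves
    separation and does not increase lengths. *)
Definition clamp lo hi (x : R) : R := Num.max lo (Num.min hi x).

Lemma clamp_ge0 lo hi x : lo <= clamp lo hi x.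
Proof. by rewrite /clamp le_max lexx. Qed.

Lemma clamp_le lo hi x : lo <= hi -> clamp lo hi x <= hi.
Proof. by move=> t0; rewrite /clamp ge_max t0 ge_min lexx. Qed.

Lemma clamp_id lo hi x : lo <= x -> x <= hi -> clamp lo hi x = x.
Proof. by move=> x0 xt; rewrite /clamp min_r// max_r. Qed.

Lemma clamp_homo lo hi x y : x <= y -> clamp lo hi x <= clamp lo hi y.
Proof.
move=> xy; rewrite /clamp; case: (ltP hi x) => ?; case: (ltP hi y) => ?;
  by rewrite /Num.max; do ?case: ifPn; rewrite -?leNgt => *; lra.
Qed.

Lemma clamp_lipschitz lo hi x y : x <= y -> clamp lo hi y - clamp lo hi x <= y - x.
Proof.
move=> xy; rewrite /clamp; case: (ltP hi x) => ?; case: (ltP hi y) => ?;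
  by rewrite /Num.max; do ?case: ifPn; rewrite -?leNgt => *; lra.
Qed.

Lemma lebesgue_stieltjes_itvoc (F : cumulative R R) (a b : R) : a <= b ->
  lebesgue_stieltjes_measure F `]a, b] = (F b - F a)%:E.
Proof.
move=> ab; rewrite /lebesgue_stieltjes_measure/measure_extension/= measurable_mu_extE/=.
  by rewrite wlength_itv_bnd.
exact: is_ocitv.
Qed.

Lemma open_interval_bounded (J : set R) (c d : R) : open J -> is_interval J ->
  J `<=` `]c, d[ -> J !=set0 -> (J = `]inf J, sup J[%classic) /\ inf J < sup J.
Proof.
move=> oJ iJ Jcd [x Jx].
have E : J = `]inf J, sup J[%classic.
  rewrite set_itvoo -interval_bounded_interior//; first by rewrite (interior_id J).1.
    by exists c => y /Jcd /=; rewrite in_itv/= => /andP[/ltW].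
  by exists d => y /Jcd /=; rewrite in_itv/= => /andP[_ /ltW].
split => //; move: Jx; rewrite {1}E/= in_itv/= => /andP[]; exact: lt_trans.
Qed.

(** An open set is a countable disjoint union of open intervals. Finitely many of them, clamped, are
    separated segments of total length below [d], so the increments of [g] add up to less than [e];
    countable additivity passes to the limit. Boundedness of [U] makes the end points of its
    components real numbers. *)
Lemma ac_stieltjes_open lo hi g (d e : R) (F : cumulative R R) (U : set R) (c1 c2 : R) :
  lo <= hi -> (forall x, F x = g (clamp lo hi x)) ->
  (forall s, subsegs lo hi s -> \sum_(p <- s) (p.2 - p.1) < d ->
    \sum_(p <- s) `|g p.2 - g p.1| < e) ->
  open U -> U `<=` `]c1, c2[ -> (mu U < d%:E)%E ->
  (lebesgue_stieltjes_measure F U <= e%:E)%E.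
Proof.
move=> t0 FE H oU Uc Ud.
pose J := open_disjoint_itv oU.
have JU k : J k `<=` U.
  by rewrite (open_disjoint_itv_bigcup oU) => x Jx; exists k.
have oJ k : open (J k) by exact: open_disjoint_itv_open.
have Jint k : J k !=set0 -> (J k = `]inf (J k), sup (J k)[%classic) /\ inf (J k) < sup (J k).
  apply: (@open_interval_bounded _ c1 c2) => //; first exact: open_disjoint_itv_is_interval.
  exact: subset_trans (JU k) Uc.
have mJ k : measurable (J k) by exact: open_measurable.
have tJ : trivIset setT J by exact: open_disjoint_itv_trivIset.
(* Empty components are sent to the degenerate segment at [hi], which is separated from every
   segment of [lo, hi]. *)
pose pr k := if J k == set0 then (hi, hi) else (clamp lo hi (inf (J k)), clamp lo hi (sup (J k))).
have pr12 k : lo <= (pr k).1 /\ (pr k).1 <= (pr k).2 /\ (pr k).2 <= hi.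
  rewrite /pr; case: eqP => [//|/eqP/set0P/Jint[_ /ltW h]] /=.
  by rewrite clamp_ge0 clamp_le// clamp_homo.
have prJ k : (((pr k).2 - (pr k).1)%:E <= mu (J k))%E.
  rewrite /pr; case: eqP => [_|/eqP/set0P/Jint[E h]] /=.
    by rewrite subrr measure_ge0.
  by rewrite [in leRHS]E lebesgue_measure_itv/= lte_fin h lee_fin clamp_lipschitz// ltW.
have nuJ k : (lebesgue_stieltjes_measure F (J k) <= (`|g (pr k).2 - g (pr k).1|)%:E)%E.
  rewrite /pr; case: eqP => [->|/eqP/set0P/Jint[E h]] /=.
    by rewrite measure0 lee_fin.
  (* The component is enlarged to a half-open interval, whose measure is the increment of [F] by
     construction. *)
  apply: (@le_trans _ _ (lebesgue_stieltjes_measure F `]inf (J k), sup (J k)])).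
    rewrite {1}E; apply: le_measure; rewrite ?inE//=; try exact: measurable_itv.
    by apply: subset_itvl; rewrite bnd_simp.
  by rewrite (lebesgue_stieltjes_itvoc F (ltW h)) lee_fin !FE ler_norm.
have main K : \sum_(0 <= k < K) `|g (pr k).2 - g (pr k).1| < e.
  rewrite -(big_map pr xpredT (fun p => `|g p.2 - g p.1|)); apply: H.
    apply/andP; split.
      by apply/allP => p /mapP[k _ ->]; apply/and3P; have [? []] := pr12 k.
    rewrite pairwise_map; apply/(pairwiseP 0%N) => i j.
    rewrite !inE size_iota subn0 => iK jK ij; rewrite !nth_iota ?subn0// !add0n /=.
    rewrite /sepitv/= /pr.
    case: (eqVneq (J i) set0) => [Ji|/set0P/Jint[Ji ltJi]] /=.
      by case: ifP => _/=; rewrite ?lexx// clamp_le// orbT.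
    case: (eqVneq (J j) set0) => [Jj|/set0P/Jint[Jj hj]] /=.
      by rewrite clamp_le.
    have /trivIsetP/(_ i j Logic.I Logic.I) := tJ; rewrite (ltn_eqF ij) => /(_ isT).
    have [h|h] := leP (sup (J i)) (inf (J j)); first by rewrite clamp_homo.
    have [h'|h'] := leP (sup (J j)) (inf (J i)); first by rewrite (clamp_homo _ _ h') orbT.
    rewrite Ji Jj => /seteqP[+ _].
    (* If neither interval lies to one side of the other, they overlap, and the midpoint of the
       overlap contradicts disjointness. *)
    move=> /(_ ((Num.max (inf (J i)) (inf (J j)) + Num.min (sup (J i)) (sup (J j))) / 2))[].
    rewrite /= !in_itv/=.
    by case: (ltP (inf (J i)) (inf (J j))) => ?; case: (ltP (sup (J i)) (sup (J j))) => ?; split; lra.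
  rewrite big_map -lte_fin -sumEFin; apply: le_lt_trans Ud.
  apply: (@le_trans _ _ (\sum_(0 <= k < K) mu (J k))%E).
    by apply: lee_sum => k _; exact: prJ.
  rewrite [in leRHS](open_disjoint_itv_bigcup oU) measure_semi_bigcup//; last first.
    exact: bigcup_measurable (fun k _ => mJ k).
  exact: nneseries_lim_ge.
rewrite [in leLHS](open_disjoint_itv_bigcup oU) measure_semi_bigcup//; last first.
  exact: bigcup_measurable (fun k _ => mJ k).
apply: lime_le; first by apply: is_cvg_nneseries => k _ _; exact: measure_ge0.
near=> K; apply: (@le_trans _ _ (\sum_(0 <= k < K) `|g (pr k).2 - g (pr k).1|%:E)%E).
  by apply: lee_sum => k _; exact: nuJ.
by rewrite sumEFin lee_fin ltW.
Unshelve. all: by end_near. Qed.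

Lemma monotone_ac_density lo hi g : lo < hi -> ac lo hi g ->
  (forall x y, lo <= x -> x <= y -> y <= hi -> g x <= g y) ->
  exists2 rho : R -> R, mu.-integrable setT (EFin \o rho) &
    forall t, lo <= t -> t <= hi -> g t = g lo + \int[mu]_(u in `[lo, t]) rho u.
Proof.
move=> lohi acg gnd; have lohi_ge0 := ltW lohi.
pose G x := g (clamp lo hi x).
have Gnd : nondecreasing_fun G.
  by move=> x y xy; apply: gnd; rewrite ?clamp_ge0 ?clamp_le ?clamp_homo.
have Gc : continuous G.
  move=> x; apply/cvgrPdist_lt => e e0.
  have [d d0 H] := ac_uniformly_continuous acg (lexx lo) (lexx hi) e0.
  near=> y.
  have : `|x - y| < d by near: y; apply: cvgr_dist_lt.
  have H' u v : u <= v -> v - u < d -> `|G v - G u| < e.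
    move=> uv uvd; apply: H; rewrite ?clamp_ge0 ?clamp_le ?clamp_homo//.
    exact: le_lt_trans (clamp_lipschitz _ _ uv) uvd.
  case: (leP x y) => xy; first by rewrite distrC => ?; rewrite distrC H'//; apply: le_lt_trans (ler_norm _) _.
  by move=> ?; rewrite H' ?(ltW xy)//; apply: le_lt_trans (ler_norm _) _.
pose F : cumulative R R := HB.pack G (isCumulative.Build R _ R G Gnd (right_continuousW Gc)).
pose nu0 := lebesgue_stieltjes_measure F.
have mD : measurable (`]lo, hi] : set (measurableTypeR R)) by exact: measurable_itv.
have nuD : (nu0 `]lo, hi]%classic < +oo)%E.
  by rewrite /nu0 lebesgue_stieltjes_itvoc// ltry.
pose nu : {finite_measure set (measurableTypeR R) -> \bar R} := mfrestr mD nuD.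
have dom : nu `<< mu.
  apply/null_content_dominatesP => A mA A0.
  apply/eqP; rewrite eq_le measure_ge0 andbT.
  apply/lee_addgt0Pr => e e0; rewrite add0e.
  have [d d0 H] := acg e e0.
  have [U [oU AU Ud]] := @lebesgue_regularity_outer R A d mA ltac:(by rewrite A0) d0.
  (* [U] is an open set of measure below [d] around the null set [A]. Since [nu] lives on ]lo, hi],
     cutting [U] down to a bounded neighbourhood of [lo, hi] loses nothing. *)
  pose V := U `&` `](lo - 1), (hi + 1)[%classic.
  have oV : open V by apply: openI => //; exact: interval_open.
  have mV : measurable V by exact: open_measurable.
  have mU : measurable U by exact: open_measurable.
  apply: (@le_trans _ _ (nu0 V)).
    apply: le_measure; rewrite ?inE//; first exact: measurableI.
    move=> x [/AU Ux]; rewrite /= in_itv/= => /andP[x0 xt]; split => //=.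
    by rewrite in_itv/=; apply/andP; split; lra.
  apply: (@ac_stieltjes_open lo hi g d e F V (lo - 1) (hi + 1)) => //.
    exact: subIsetr.
  apply: le_lt_trans Ud; apply: (@le_trans _ _ (mu U)).
    by apply: le_measure; rewrite ?inE//; exact: subIsetl.
  rewrite (measureDI mu mU mA) [X in (_ + X)%E](_ : _ = 0)%E ?adde0//.
  apply/eqP; rewrite eq_le measure_ge0 andbT -A0.
  by apply: le_measure; rewrite ?inE//; exact: measurableI.
have [f [f0 ffin fint fE]] := radon_nikodym_sigma_finite dom.
have rhoE : EFin \o (fine \o f) = f by apply/funext => x /=; rewrite fineK.
exists (fine \o f); first by rewrite rhoE.
move=> t t_ge0 tt.
have := fE `]lo, t]%classic (measurable_itv _).
have -> : nu `]lo, t]%classic = (g t - g lo)%:E.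
  rewrite /nu/= /mfrestr /mrestr setIidl; last by apply: subset_itvl; rewrite bnd_simp.
  by rewrite /nu0 lebesgue_stieltjes_itvoc//= /G !clamp_id.
move=> E; rewrite -Rintegral_itv_obnd_cbnd; last first.
  by rewrite rhoE; apply: integrableS fint => //.
have := congr1 fine E; rewrite /Rintegral /= => E'.
rewrite -[X in fine (integral _ _ X)]/(EFin \o (fine \o f)) rhoE -E'; ring.
Unshelve. all: by end_near. Qed.

Lemma integrable_funD (D : set (measurableTypeR R)) f g : measurable D ->
  mu.-integrable D (EFin \o f) -> mu.-integrable D (EFin \o g) ->
  mu.-integrable D (EFin \o (fun x => f x + g x)).
Proof. by move=> mD intf intg; exact: (integrableD mD intf intg). Qed.

Lemma integrable_funZ (D : set (measurableTypeR R)) (k : R) f : measurable D ->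
  mu.-integrable D (EFin \o f) -> mu.-integrable D (EFin \o (fun x => k * f x)).
Proof. by move=> mD intf; exact: (integrableZl mD k intf). Qed.

Lemma integrable_funB (D : set (measurableTypeR R)) f g : measurable D ->
  mu.-integrable D (EFin \o f) -> mu.-integrable D (EFin \o g) ->
  mu.-integrable D (EFin \o (fun x => f x - g x)).
Proof. by move=> mD intf intg; exact: (integrableB mD intf intg). Qed.

Lemma ac_density lo hi f : lo < hi -> ac lo hi f ->
  exists2 rho : R -> R, mu.-integrable setT (EFin \o rho) &
    forall t, lo <= t -> t <= hi -> f t = f lo + \int[mu]_(u in `[lo, t]) rho u.
Proof.
move=> lohi acf; pose V t := fine (total_variation lo t f).
have acV : ac lo hi V := ac_total_variation acf.
have VB x y : lo <= x -> x <= y -> y <= hi -> `|f y - f x| <= V y - V x.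
  move=> x0 xy yt; rewrite -lee_fin -(fine_total_variationB acf x0 xy yt).
  exact: total_variation_ge.
have acW : ac lo hi (V \+ (fun t => - f t)).
  apply: acD => // e e0; have [d d0 H] := acf e e0; exists d => // s sI sd.
  by under eq_bigr do rewrite -opprD normrN; exact: H.
have [r1 ir1 H1] := monotone_ac_density lohi acV
  (fun x y x0 xy yt => ltac:(have := VB x y x0 xy yt; have := normr_ge0 (f y - f x); lra)).
have [r2 ir2 H2] := monotone_ac_density lohi acW
  (fun x y x0 xy yt => ltac:(have /= := VB x y x0 xy yt; have := ler_norm (f y - f x); lra)).
exists (fun x => r1 x - r2 x); first exact: integrable_funB.
move=> t t0 tt; rewrite RintegralB//.
- by have := H1 _ t0 tt; have /= := H2 _ t0 tt; lra.
- exact: integrableS ir1.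
- exact: integrableS ir2.
Qed.

End Density.

#[local] Instance ae_lebesgue_filter (R : realType) :
  Filter (nbhs (almost_everywhere (@lebesgue_measure R))).
Proof. exact: ae_filter_ringOfSetsType. Qed.

(** * Indefinite integrals: differentiation almost everywhere, product rule, absolute continuity *)

Section Primitive.
Context {R : realType}.
Notation mu := (@lebesgue_measure R).
Implicit Types (f g : R -> R) (lo hi : R).

(** [rho] is any version of the derivative of [f]. The integral representation is stable under
    restriction, linear combinations and changes on null sets, and it does not see the values of
    [derive1] where [f] is not differentiable. *)
Definition primitive lo hi f rho :=
  mu.-integrable `[lo, hi] (EFin \o rho) /\
  forall t, lo <= t -> t <= hi -> f t = f lo + \int[mu]_(u in `[lo, t]) rho u.

Lemma integrable_subseg (a b c d : R) f : a <= c -> d <= b ->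
  mu.-integrable `[a, b] (EFin \o f) -> mu.-integrable `[c, d] (EFin \o f).
Proof.
move=> ac db; apply: integrableS => //.
by apply: subset_itvScc; rewrite bnd_simp.
Qed.

Lemma Rintegral_itv_cat f (a b c : R) : a <= b -> b <= c ->
  mu.-integrable `[a, c] (EFin \o f) ->
  \int[mu]_(u in `[a, c]) f u = \int[mu]_(u in `[a, b]) f u + \int[mu]_(u in `[b, c]) f u.
Proof.
move=> ab bc intf.
have := @Rintegral_itvB R f (BLeft a) (BRight c) b intf ltac:(by rewrite bnd_simp) ltac:(by rewrite bnd_simp).
rewrite Rintegral_itv_obnd_cbnd; first by move=> <-; ring.
by apply: integrableS intf => //; apply: subset_itv; rewrite bnd_simp.
Qed.

Lemma primitive_itv lo hi f rho s t : primitive lo hi f rho ->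
  lo <= s -> s <= t -> t <= hi -> f t - f s = \int[mu]_(u in `[s, t]) rho u.
Proof.
move=> [int H] s0 st tt; rewrite (H t) ?(H s); try lra.
rewrite (@Rintegral_itv_cat _ lo s t) //; first ring.
by apply: integrable_subseg int.
Qed.

Lemma ae_neq (c : R) : {ae mu, forall x, x != c}.
Proof.
exists [set c]; split; first exact: measurable_set1.
  exact: lebesgue_measure_set1.
by move=> x /= /negP; rewrite negbK => /eqP.
Qed.

Lemma ae_itvoo_itvcc (a b : R) (P : R -> Prop) :
  {ae mu, forall t, a < t < b -> P t} ->
  {ae mu, forall t, `[a, b]%classic t -> P t}.
Proof.
move=> H; near=> t; rewrite /= in_itv/= => /andP[at_ tb].
have ta : t != a by near: t; exact: ae_neq.
have tb' : t != b by near: t; exact: ae_neq.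
have : a < t < b by rewrite !lt_neqAle at_ tb tb' eq_sym ta.
by near: t.
Unshelve. all: by end_near. Qed.

(** Lebesgue differentiation applies to the indefinite integral of [rho] extended by 0. Near an
    interior point [f] differs from that integral by a constant, and being differentiable is a local
    property. *)
Lemma primitive_is_derive lo hi f rho : primitive lo hi f rho ->
  {ae mu, forall t, lo < t < hi -> is_derive t 1 f (rho t)}.
Proof.
move=> [int H].
pose r := rho \_ `[lo, hi].
have intr : mu.-integrable setT (EFin \o r).
  by rewrite /r -restrict_EFin -integrable_mkcond.
have intry y : mu.-integrable [set` Interval (BLeft lo) (BRight y)] (EFin \o r).
  by apply: integrableS intr => //.
have := @FTC1 R r (BLeft lo) intry (open_integrable_locally openT intr).
apply: filterS => t Ht /andP[t0 tt].
have [Fd FE] := Ht ltac:(by rewrite lte_fin).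
pose F (x : R) : R := \int[mu]_(u in `[lo, x]) r u.
have rt : r t = rho t by rewrite /r patchE mem_set//= in_itv/= !ltW.
have dF : is_derive t 1 F (rho t).
  by apply: DeriveDef; [exact: Fd|rewrite -derive1E -rt].
have dF0 : is_derive t 1 (fun x => f lo + F x) (rho t).
  by have := is_deriveD (is_derive_cst (f lo) t 1) dF; rewrite add0r.
apply: near_eq_is_derive dF0; near=> x.
have x0 : lo < x by near: x; exact: lt_nbhsr.
have xt : x < hi by near: x; exact: lt_nbhsl.
rewrite (H x (ltW x0) (ltW xt)); congr (_ + _); rewrite /F.
apply: eq_Rintegral => u; rewrite inE/= in_itv/= => /andP[u0 ux].
by rewrite /r patchE mem_set//= in_itv/=; lra.
Unshelve. all: by end_near. Qed.

Lemma primitive_ae lo hi f rho rho' : primitive lo hi f rho ->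
  measurable_fun `[lo, hi] rho' ->
  {ae mu, forall t, lo < t < hi -> rho t = rho' t} ->
  primitive lo hi f rho'.
Proof.
move=> [int H] mr /ae_itvoo_itvcc ae.
have mI (t : R) : measurable (`[lo, t] : set (measurableTypeR R)) by exact: measurable_itv.
have mrho' : measurable_fun `[lo, hi] (EFin \o rho') by exact/measurable_EFinP.
have /integrableP[mrho fin] := int.
have E t : t <= hi ->
    (\int[mu]_(x in `[lo, t]) (rho x)%:E = \int[mu]_(x in `[lo, t]) (rho' x)%:E)%E.
  move=> tt; have sub : `[lo, t]%classic `<=` `[lo, hi]%classic by apply: subset_itvl; rewrite bnd_simp.
  apply: (@ae_eq_integral _ _ _ mu) => //.
  - exact: measurable_funS mrho.
  - exact: measurable_funS mrho'.
  - by apply: filterS ae => x h xt /=; rewrite h//; exact: sub.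
split.
  apply/integrableP; split => //.
  have -> : (\int[mu]_(x in `[lo, hi]) `|(EFin \o rho') x| =
         \int[mu]_(x in `[lo, hi]) `|(EFin \o rho) x|)%E => //.
  apply: (@ae_eq_integral _ _ _ mu) => //.
  - exact: measurableT_comp.
  - exact: measurableT_comp.
  - by apply: filterS ae => x h xt /=; rewrite h.
by move=> t t0 tt; rewrite (H t t0 tt) /Rintegral E.
Qed.

Lemma ac_primitive_derive1 lo hi f : lo < hi -> ac lo hi f ->
  measurable_fun `[lo, hi] (derive1 f) -> primitive lo hi f (derive1 f).
Proof.
move=> lohi acf mf; have [rho int H] := ac_density lohi acf.
have P : primitive lo hi f rho by split => //; apply: integrableS int.
apply: (primitive_ae P) => //.
have := primitive_is_derive P; apply: filterS => t h tt.
by have /= ? := h tt; rewrite derive1E derive_val.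
Qed.

Lemma ac_derivable lo hi f : lo < hi -> ac lo hi f ->
  {ae mu, forall t, lo < t < hi -> derivable f t 1}.
Proof.
move=> lohi acf; have [rho int H] := ac_density lohi acf.
have P : primitive lo hi f rho by split => //; apply: integrableS int.
by have := primitive_is_derive P; apply: filterS => t h /h [].
Qed.

Lemma ac_measurable lo hi f : lo < hi -> ac lo hi f -> measurable_fun `[lo, hi] f.
Proof.
move=> lohi acf; apply: subspace_continuous_measurable_fun => //.
exact: ac_continuous.
Qed.

Lemma integrable_funM_bounded (D : set (measurableTypeR R)) f g (B : R) : measurable D ->
  measurable_fun D f -> (forall x, D x -> `|f x| <= B) ->
  mu.-integrable D (EFin \o g) -> mu.-integrable D (EFin \o (fun x => f x * g x)).
Proof.
move=> mD mf fB intg; apply: (@integrableMr _ _ _ mu D mD f (EFin \o g)) => //.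
exists B; split; first exact: num_real.
by move=> M BM x Dx /=; rewrite (le_trans (fB x Dx))// ltW.
Qed.

Lemma ac_integrable_mul lo hi f g : lo < hi -> ac lo hi f ->
  mu.-integrable `[lo, hi] (EFin \o g) ->
  mu.-integrable `[lo, hi] (EFin \o (fun x => f x * g x)).
Proof.
move=> lohi acf.
have [B B0 fB] := within_continuous_bounded (ltW lohi) (ac_continuous lohi acf).
apply: (@integrable_funM_bounded _ _ _ B) => //; first exact: ac_measurable.
by move=> x; rewrite /= in_itv/= => /andP[]; exact: fB.
Qed.

(** The product is absolutely continuous and thus has some density. Almost everywhere all three
    functions are differentiable, and there the pointwise product rule identifies this density. *)
Lemma primitiveM lo hi f g rf rg : lo < hi -> ac lo hi f -> ac lo hi g ->
  primitive lo hi f rf -> primitive lo hi g rg ->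
  primitive lo hi (f \* g) (fun t => f t * rg t + g t * rf t).
Proof.
move=> lohi acf acg Pf Pg.
have [rho int H] := ac_density lohi (acM lohi acf acg).
have P : primitive lo hi (f \* g) rho by split => //; apply: integrableS int.
have I : mu.-integrable `[lo, hi] (EFin \o (fun t => f t * rg t + g t * rf t)).
  apply: integrable_funD => //; apply: ac_integrable_mul => //; [by case: Pg|by case: Pf].
apply: (primitive_ae P).
  by apply/measurable_EFinP; case/integrableP: I.
have := primitive_is_derive P; have := primitive_is_derive Pf.
have := primitive_is_derive Pg; apply: filterS3 => t hg hf h tt.
have /= [_ E1] := h tt; have /= df := hf tt; have /= dg := hg tt.
have [_ E2] := is_deriveM df dg; exact: etrans (esym E1) E2.
Qed.

Lemma primitiveD lo hi f g rf rg : primitive lo hi f rf -> primitive lo hi g rg ->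
  primitive lo hi (fun t => f t + g t) (fun t => rf t + rg t).
Proof.
move=> [If Hf] [Ig Hg]; split; first exact: integrable_funD.
move=> t t0 tt; rewrite (Hf t t0 tt) (Hg t t0 tt) RintegralD//; first ring.
  exact: integrable_subseg If.
exact: integrable_subseg Ig.
Qed.

Lemma primitiveZ lo hi k f rf : primitive lo hi f rf ->
  primitive lo hi (fun t => k * f t) (fun t => k * rf t).
Proof.
move=> [If Hf]; split; first exact: integrable_funZ.
move=> t t0 tt; rewrite (Hf t t0 tt) RintegralZl//; first ring.
exact: integrable_subseg If.
Qed.

Lemma primitive_continuous lo hi f f' : lo < hi ->
  {within `[lo, hi], continuous f'} ->
  (forall t, lo <= t -> t <= hi -> is_derive t 1 f (f' t)) ->
  primitive lo hi f f'.
Proof.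
move=> lohi cf' df; split.
  apply: continuous_compact_integrable => //; exact: segment_compact.
move=> t; rewrite le_eqVlt => /predU1P[<- _|t0 tt].
  by rewrite set_itv1 Rintegral_set1 addr0.
have cf't : {within `[lo, t], continuous f'}.
  by apply: continuous_subspaceW cf'; apply: subset_itvl; rewrite bnd_simp.
have dc x : lo <= x -> x <= hi -> {for x, continuous f}.
  move=> x0 xt; apply/differentiable_continuous/derivable1_diffP.
  by have [] := df x x0 xt.
rewrite /Rintegral (@continuous_FTC2 _ f' f)//=; first ring.
- split.
  + by move=> x; rewrite in_itv/= => /andP[x0 xt]; have [] := df x (ltW x0) (le_trans (ltW xt) tt).
  + by apply: cvg_at_right_filter; apply: dc; lra.
  + by apply: cvg_at_left_filter; apply: dc; lra.
- by move=> x; rewrite in_itv/= => /andP[x0 xt]; rewrite derive1E; have [] := df x (ltW x0) (le_trans (ltW xt) tt).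
Qed.

(** Half-open intervals remain disjoint when adjacent and are empty when degenerate, so that lengths
    and integrals over separated segments add up exactly. *)
Lemma subsegs_cons lo hi p (s : seq (R * R)) : subsegs lo hi (p :: s) ->
  [/\ subseg lo hi p, subsegs lo hi s &
    `]p.1, p.2] `&` \big[setU/set0]_(q <- s) `]q.1, q.2]%classic = set0].
Proof.
rewrite /subsegs/= => /andP[/andP[sp ss] /andP[ps pws]]; split; rewrite ?ss//.
apply/seteqP; split => // x [/= xp].
rewrite -bigcup_seq => -[q /= qs].
move: xp; rewrite !in_itv/= => /andP[a b] /andP[c d].
by have := allP ps q qs; rewrite /sepitv => /orP[h|h]; lra.
Qed.

Lemma lebesgue_measure_subsegs (s : seq (R * R)) lo hi : subsegs lo hi s ->
  mu (\big[setU/set0]_(p <- s) `]p.1, p.2]%classic) = (\sum_(p <- s) (p.2 - p.1))%:E.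
Proof.
elim: s => [|p s ih] /=; first by rewrite !big_nil measure0.
move=> /subsegs_cons[/and3P[p0 p12 pt] ss ps0].
have E : mu `]p.1, p.2]%classic = (p.2 - p.1)%:E.
  rewrite lebesgue_measure_itv/= lte_fin.
  by case: ltP => // p21; rewrite (_ : p.2 = p.1) ?subrr//; lra.
rewrite !big_cons EFinD -ih// -E.
by apply: (@measureU _ _ _ mu) => //; exact: bigsetU_measurable.
Qed.

Lemma Rintegral_subsegs (g : R -> R) (s : seq (R * R)) lo hi : subsegs lo hi s ->
  mu.-integrable setT (EFin \o g) ->
  \int[mu]_(x in \big[setU/set0]_(p <- s) `]p.1, p.2]%classic) g x =
  \sum_(p <- s) \int[mu]_(x in `]p.1, p.2]) g x.
Proof.
move=> + intg; elim: s => [|p s ih] /=; first by rewrite !big_nil Rintegral_set0.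
move=> /subsegs_cons[_ ss ps0].
have mU : measurable (\big[setU/set0]_(q <- s) (`]q.1, q.2]%classic : set (measurableTypeR R))).
  exact: bigsetU_measurable.
rewrite !big_cons -ih// Rintegral_setU //.
- by apply: integrableS intg => //; exact: measurableU.
- by apply/disj_setPS; rewrite ps0.
Qed.

(** The integral of [|rho|] over a set is small when the measure of the set is; this is applied to
    the union of the segments. It is the converse of [ac_density], and it makes explicitly built
    functions absolutely continuous. *)
Lemma primitive_ac lo hi f rho : primitive lo hi f rho -> ac lo hi f.
Proof.
move=> P; have [int H] := P; move=> e e0.
pose r := rho \_ `[lo, hi].
have intr : mu.-integrable setT (EFin \o r).
  by rewrite /r -restrict_EFin -integrable_mkcond.
have [d [d0 Hd]] := integral_normr_continuous intr e0.
exists d => // s ss sd.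
pose U := \big[setU/set0]_(p <- s) (`]p.1, p.2]%classic : set (measurableTypeR R)).
have mU : measurable U by apply: bigsetU_measurable.
have allsub (p : R * R) : p \in s -> subseg lo hi p by move: ss => /andP[/allP h _] /h.
have Ud : (mu U < d%:E)%E by rewrite (lebesgue_measure_subsegs ss) lte_fin.
apply: le_lt_trans (Hd U mU Ud).
rewrite /U (Rintegral_subsegs ss); last exact: integrable_norm.
rewrite big_seq [leRHS]big_seq; apply: ler_sum => p /allsub/and3P[p0 p12 pt].
rewrite (primitive_itv P)//.
have Ip : mu.-integrable `[p.1, p.2] (EFin \o rho) by apply: integrable_subseg int.
rewrite -Rintegral_itv_obnd_cbnd; last first.
  by apply: integrableS Ip => //; apply: subset_itvr; rewrite bnd_simp.
rewrite (@eq_Rintegral _ _ _ mu _ r); last first.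
  move=> x; rewrite inE/= in_itv/= => /andP[x1 x2].
  by rewrite /r patchE mem_set//= in_itv/=; lra.
by apply: le_normr_Rintegral => //; apply: integrableS intr.
Qed.

End Primitive.

(** * Square integrable functions and the Wirtinger inequality *)

Section Young.
Context {R : realType}.
Implicit Types A B E I : R.

(* The infimum over [s] of the right-hand side is [(A + B)^2]; it is approached along
   [s = (B + eta) / (A + eta)] even when [A] or [B] vanishes. *)
Lemma young_sqr E A B : 0 <= A -> 0 <= B ->
  (forall s, 0 < s -> E <= (1 + s) * A ^+ 2 + (1 + s^-1) * B ^+ 2) ->
  E <= (A + B) ^+ 2.
Proof.
move=> A0 B0 H; apply/ler_addgt0Pr => e e0.
(* For [eta <= 1], replacing [A] and [B] by [A + eta] and [B + eta] increases the square by
   [4 eta (A + B) + 4 eta^2 <= eta D], which is at most [e]. *)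
pose D := 4 * (A + B) + 4.
have D0 : 0 < D by rewrite /D; lra.
pose eta := Num.min 1 (e / D).
have eta0 : 0 < eta by rewrite lt_min ltr01 divr_gt0.
have eta1 : eta <= 1 by rewrite ge_min lexx.
have etae : eta * D <= e by rewrite -ler_pdivlMr// ge_min lexx orbT.
have A' : 0 < A + eta by lra.
have B' : 0 < B + eta by lra.
have s0 : 0 < (B + eta) / (A + eta) by rewrite divr_gt0.
have := H _ s0 => {}H.
suff : E <= (A + eta + (B + eta)) ^+ 2.
  have : eta * eta <= eta by rewrite ler_piMl// ltW.
  by move: etae; rewrite /D; nra.
have -> : (A + eta + (B + eta)) ^+ 2 =
   (1 + (B + eta) / (A + eta)) * (A + eta) ^+ 2 + (1 + ((B + eta) / (A + eta))^-1) * (B + eta) ^+ 2.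
  by field; rewrite !gt_eqF.
apply: (le_trans H); apply: lerD; apply: ler_wpM2l.
- by lra.
- by rewrite ler_sqr ?nnegrE; lra.
- by rewrite addr_ge0// invr_ge0 ltW.
- by rewrite ler_sqr ?nnegrE; lra.
Qed.

(** Apply [young_sqr] to [A^2 + B^2 + 2 I]. Cauchy-Schwarz, in R^n as in L^2, then only requires
    summing or integrating the pointwise [young_ineq]. *)
Lemma young_mul I A B : 0 <= A -> 0 <= B ->
  (forall s, 0 < s -> 2 * I <= s * A ^+ 2 + s^-1 * B ^+ 2) -> I <= A * B.
Proof.
move=> A0 B0 H.
have : A ^+ 2 + B ^+ 2 + 2 * I <= (A + B) ^+ 2.
  by apply: young_sqr => // s s0; have := H s s0; lra.
by rewrite sqrrD; lra.
Qed.

Lemma young_ineq (s x y : R) : 0 < s -> 2 * (x * y) <= s * x ^+ 2 + s^-1 * y ^+ 2.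
Proof.
move=> s0; have s1 : s * s^-1 = 1 by rewrite divff// gt_eqF.
have si : 0 < s^-1 by rewrite invr_gt0.
have h : 0 <= s^-1 * (s * x - y) ^+ 2 by rewrite mulr_ge0 ?sqr_ge0// ltW.
have E : s^-1 * (s * x - y) ^+ 2 = s * x ^+ 2 + s^-1 * y ^+ 2 - 2 * (x * y).
  by field; rewrite gt_eqF.
by rewrite E in h; lra.
Qed.

End Young.

Section SquareIntegrable.
Context {R : realType}.
Notation mu := (@lebesgue_measure R).
Implicit Types (f g : R -> R) (lo hi tau : R).

(** Measurability of [f] is a clause of its own, as that of its square does not imply it. *)
Definition sqint lo hi f := measurable_fun `[lo, hi] f /\
  mu.-integrable `[lo, hi] (EFin \o (fun t => f t ^+ 2)).

Lemma L2_sqint tau f : L2 tau f <-> sqint 0 tau f.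
Proof.
have mI : measurable (`[0, tau] : set (measurableTypeR R)) by exact: measurable_itv.
have E : EFin \o (fun x => (f \_ `[0, tau]) x ^+ 2) =
    (EFin \o (fun t => f t ^+ 2)) \_ `[0, tau].
  by apply/funext => x /=; rewrite !patchE; case: ifP => //=; rewrite expr0n.
split.
- move=> L; split.
    have := sub_Lfun_mfun L; rewrite inE /= => mf.
    have [_] := @measurable_restrict _ _ R R `[0, tau] setT f (measurable_itv _) measurableT.
    by rewrite setTI; apply.
  apply/integrable_mkcond => //; rewrite -E.
  exact: Lfun2_integrable_sqr.
- move=> [mf intf]; rewrite /L2 inE; apply/andP; split; rewrite inE /=.
    apply/(@measurable_restrict _ _ R R `[0, tau] setT) => //.
    by rewrite setTI.
  rewrite /finite_norm unlock; apply: poweR_lty.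
  move: intf => /integrable_mkcond -/(_ mI); rewrite -E => /integrableP[_].
  apply: le_lt_trans; rewrite le_eqVlt; apply/orP; left; apply/eqP.
  apply: eq_integral => x _ /=.
  by rewrite powR_mulrn// normrX.
Qed.

Lemma sqintM lo hi f g : sqint lo hi f -> sqint lo hi g ->
  mu.-integrable `[lo, hi] (EFin \o (fun t => f t * g t)).
Proof.
move=> [mf If] [mg Ig].
have mI : measurable (`[lo, hi] : set (measurableTypeR R)) by exact: measurable_itv.
have I := integrable_funD mI If Ig.
apply: (@le_integrable _ _ _ mu _ mI _ _ _ _ I).
  by apply/measurable_EFinP; exact: measurable_funM.
move=> x _ /=; rewrite lee_fin normrM [leRHS]ger0_norm; last by rewrite addr_ge0 ?sqr_ge0.
have := young_ineq `|f x| `|g x| (@ltr01 R).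
rewrite !real_normK ?num_real// invr1; have := sqr_ge0 (f x); have := sqr_ge0 (g x).
by have := normr_ge0 (f x); have := normr_ge0 (g x); nra.
Qed.

Lemma sqintD lo hi f g : sqint lo hi f -> sqint lo hi g ->
  sqint lo hi (fun t => f t + g t).
Proof.
move=> sf sg; split; first by case: sf => mf _; case: sg => mg _; exact: measurable_funD.
have mI : measurable (`[lo, hi] : set (measurableTypeR R)) by exact: measurable_itv.
have := integrable_funD mI (integrable_funD mI (proj2 sf) (proj2 sg)) (integrable_funZ 2 mI (sqintM sf sg)).
by apply: (eq_integrable mI) => x _; congr EFin => /=; ring.
Qed.

Lemma sqintZ lo hi k f : sqint lo hi f -> sqint lo hi (fun t => k * f t).
Proof.
move=> [mf If]; split; first exact: measurable_funM.
have mI : measurable (`[lo, hi] : set (measurableTypeR R)) by exact: measurable_itv.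
have := integrable_funZ (k ^+ 2) mI If.
by apply: (eq_integrable mI) => x _; congr EFin => /=; ring.
Qed.

Lemma sqintB lo hi f g : sqint lo hi f -> sqint lo hi g ->
  sqint lo hi (fun t => f t - g t).
Proof.
move=> sf sg; have := sqintD sf (sqintZ (-1) sg).
by under eq_fun do rewrite mulN1r.
Qed.

Lemma within_continuous_sqr (A : set R) f : {within A, continuous f} ->
  {within A, continuous (fun t => f t ^+ 2)}.
Proof. by move=> cf x; exact: (continuousM (cf x) (cf x)). Qed.

Lemma continuous_sqint lo hi f : {within `[lo, hi], continuous f} -> sqint lo hi f.
Proof.
move=> cf; split; first exact: subspace_continuous_measurable_fun.
apply: continuous_compact_integrable; first exact: segment_compact.
exact: within_continuous_sqr.
Qed.

Lemma ac_sqint lo hi f : lo < hi -> ac lo hi f -> sqint lo hi f.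
Proof. by move=> lohi acf; apply: continuous_sqint; exact: ac_continuous. Qed.

Lemma cst_sqint lo hi k : sqint lo hi (fun _ => k).
Proof. by apply: continuous_sqint; apply: continuous_subspaceT => x; exact: cst_continuous. Qed.

Lemma sqint_integrable lo hi f : sqint lo hi f -> mu.-integrable `[lo, hi] (EFin \o f).
Proof.
move=> sf; have := sqintM (cst_sqint lo hi 1) sf.
by apply: eq_integrable => // x _; rewrite /= mul1r.
Qed.

Lemma sqint_sub lo hi f a b : lo <= a -> b <= hi -> sqint lo hi f -> sqint a b f.
Proof.
move=> la bh [mf If]; split.
  apply: measurable_funS mf => //; apply: subset_itvScc; rewrite bnd_simp//.
exact: integrable_subseg If.
Qed.

Lemma ac_sub_itv lo hi f a b : lo <= a -> b <= hi -> ac lo hi f -> ac a b f.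
Proof.
move=> la bh acf e e0; have [d d0 H] := acf e e0; exists d => // s /andP[s1 s2].
apply: H; rewrite /subsegs s2 andbT; apply: sub_all s1 => p /and3P[p1 p2 p3].
by rewrite /subseg; lra.
Qed.

Lemma primitive_sub lo hi f rho a b : lo <= a -> b <= hi ->
  primitive lo hi f rho -> primitive a b f rho.
Proof.
move=> la bh P; split; first by case: P => I _; exact: integrable_subseg I.
move=> t at_ tb; rewrite -(primitive_itv P) //; [ring|lra].
Qed.

Lemma Rintegral_by_parts_ac lo hi f g rf rg : lo < hi -> ac lo hi f -> ac lo hi g ->
  primitive lo hi f rf -> primitive lo hi g rg ->
  \int[mu]_(t in `[lo, hi]) (f t * rg t) =
  f hi * g hi - f lo * g lo - \int[mu]_(t in `[lo, hi]) (g t * rf t).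
Proof.
move=> lohi acf acg Pf Pg.
have [_ /(_ hi (ltW lohi) (lexx _))] := primitiveM lohi acf acg Pf Pg.
rewrite /= RintegralD//; first lra.
- by apply: ac_integrable_mul => //; case: Pg.
- by apply: ac_integrable_mul => //; case: Pf.
Qed.

Lemma Rintegral_cst_itv a b (c : R) : a <= b -> \int[mu]_(_ in `[a, b]) c = c * (b - a).
Proof.
rewrite le_eqVlt => /predU1P[<-|ab].
  by rewrite set_itv1 Rintegral_set1 subrr mulr0.
have E : mu `[a, b]%classic = (b - a)%:E by rewrite lebesgue_measure_itv/= lte_fin ab.
have mI : measurable (`[a, b] : set (measurableTypeR R)) by exact: measurable_itv.
by have := Rintegral_cst mu mI c => ->; congr (_ * _); have /= -> := congr1 fine E.
Qed.

Lemma Rintegral_sqr_ge0 (D : set R) f : 0 <= \int[mu]_(t in D) f t ^+ 2.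
Proof. by apply: Rintegral_ge0 => x _; exact: sqr_ge0. Qed.

Lemma cos_itv_gt0 a b (k t : R) : 0 <= k -> k * (b - a) < pi -> a <= t -> t <= b ->
  0 < cos (k * (t - (a + b) / 2)).
Proof.
move=> k0 kpi at_ tb; apply: cos_gt0_pihalf.
have h1 : k * (t - a) >= 0 by rewrite mulr_ge0// subr_ge0.
have h2 : k * (b - t) >= 0 by rewrite mulr_ge0// subr_ge0.
by apply/andP; split; lra.
Qed.

(* Integrate [(w' + T w)^2 = w'^2 - k^2 w^2 + (T w^2)'], where [T t = k tan (k (t - c))]
   solves [T' = k^2 + T^2] and, [c] being the midpoint, is smooth up to the end points. *)
Lemma wirtinger_subcritical a b w w' (k : R) : a < b -> ac a b w -> primitive a b w w' ->
  sqint a b w' -> w a = 0 -> w b = 0 -> 0 <= k -> k * (b - a) < pi ->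
  k ^+ 2 * \int[mu]_(t in `[a, b]) w t ^+ 2 <= \int[mu]_(t in `[a, b]) w' t ^+ 2.
Proof.
move=> ab acw Pw sw' wa wb k0 kpi.
pose th (t : R) : R := k * (t - (a + b) / 2).
pose T (t : R) : R := k * tan (th t).
pose T' (t : R) : R := k ^+ 2 + T t ^+ 2.
have cosn0 t : a <= t -> t <= b -> cos (th t) != 0.
  by move=> at_ tb; rewrite gt_eqF//; exact: cos_itv_gt0.
have dth (t : R) : is_derive t (1 : R) th k.
  rewrite /th; apply: is_derive_eq.
  by rewrite /GRing.scale/= !(mulr0, mul0r, addr0, mulr1, subr0).
have dT (t : R) : a <= t -> t <= b -> is_derive t (1 : R) T (T' t).
  move=> at_ tb; have dtan := is_derive_tan (cosn0 t at_ tb).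
  have dc := is_derive1_comp dtan (dth t).
  have := is_deriveZ k dc; rewrite /T' /T => H.
  have -> : k ^+ 2 + (k * tan (th t)) ^+ 2 = k *: (cos (th t) ^- 2 * k).
    by rewrite cos2_tan2 ?cosn0// /GRing.scale/=; ring.
  exact: H.
have cT (t : R) : a <= t -> t <= b -> {for t, continuous T}.
  move=> at_ tb; apply/differentiable_continuous/derivable1_diffP.
  by have [] := dT t at_ tb.
have cT' : {within `[a, b], continuous T'}.
  apply: continuous_in_subspaceT => t; rewrite inE/= in_itv/= => /andP[at_ tb].
  apply: (@continuousD _ _ _ (cst (k ^+ 2)) (fun t => T t ^+ 2)).
    exact: cst_continuous.
  by have cTt := cT t at_ tb; exact: (continuousM cTt cTt).
have PT : primitive a b T T' by apply: primitive_continuous.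
have acT := primitive_ac PT.
have acww := acM ab acw acw.
have Pww := primitiveM ab acw acw Pw Pw.
have [I0 /(_ b (ltW ab) (lexx b))] := primitiveM ab acww acT Pww PT.
rewrite /= wa wb !mul0r add0r => /esym int0.
rewrite -RintegralZl//; last by have [] := ac_sqint ab acw.
have I2 := proj2 sw'.
rewrite -[leRHS]addr0 -int0 -RintegralD//.
apply: le_Rintegral => //.
- by apply: integrable_funZ => //; have [] := ac_sqint ab acw.
- exact: integrable_funD.
move=> t; rewrite /= in_itv/= => /andP[at_ tb].
have := sqr_ge0 (w' t + T t * w t); rewrite /T'; lra.
Qed.

(** At [k = pi / (b - a)] the tangent blows up at both ends, so the sharp constant is reached as a
    limit of subcritical ones, [k = (1 - eps) pi / (b - a)]. *)
Lemma wirtinger a b w w' : a < b -> ac a b w -> primitive a b w w' ->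
  sqint a b w' -> w a = 0 -> w b = 0 ->
  (pi / (b - a)) ^+ 2 * \int[mu]_(t in `[a, b]) w t ^+ 2 <= \int[mu]_(t in `[a, b]) w' t ^+ 2.
Proof.
move=> ab acw Pw sw' wa wb.
set I := Rintegral _ _ _; set J := Rintegral _ _ _.
have I0 : 0 <= I by exact: Rintegral_sqr_ge0.
have ba : 0 < b - a by lra.
have pi0 := pi_gt0 R.
set X := _ * I.
have X0 : 0 <= X by rewrite mulr_ge0// sqr_ge0.
apply/ler_addgt0Pr => e e0.
(* From [X (1 - eps)^2 <= J] follows [X <= J + 2 eps X], and [2 eps X <= e] by this choice; the
   summand [e] keeps the denominator positive when [X] is 0. *)
pose eps := e / (2 * X + e).
have De : 0 < 2 * X + e by lra.
have eps0 : 0 < eps by rewrite divr_gt0.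
have eps1 : eps <= 1 by rewrite ler_pdivrMr// mul1r; lra.
have epsX : eps * (2 * X) <= e.
  by rewrite /eps mulrAC ler_pdivrMr// ler_wpM2l; lra.
have k0 : 0 <= pi / (b - a) * (1 - eps) by rewrite mulr_ge0 ?divr_ge0 ?subr_ge0// ltW.
have kpi : pi / (b - a) * (1 - eps) * (b - a) < pi.
  rewrite mulrAC divfK ?gt_eqF// gtr_pMr//; lra.
have := wirtinger_subcritical ab acw Pw sw' wa wb k0 kpi.
rewrite -/I -/J exprMn mulrAC -/X.
have : 0 <= X * eps ^+ 2 by rewrite mulr_ge0// sqr_ge0.
by nra.
Qed.

Lemma linear_interpolation_error a b x x' : a < b -> ac a b x -> primitive a b x x' ->
  sqint a b x' ->
  (pi / (b - a)) ^+ 2 * \int[mu]_(t in `[a, b])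
     (x t - ((b - t) / (b - a) * x a + (t - a) / (b - a) * x b)) ^+ 2 <=
  \int[mu]_(t in `[a, b]) x' t ^+ 2.
Proof.
move=> ab acx Px sx'; have ba : b - a != 0 by rewrite gt_eqF// subr_gt0.
(* [m] is the slope of the interpolant and the mean of x' at once; [l] is the interpolant with
   opposite sign. Hence the integral of [(x' - m)^2] is that of [x'^2] minus [m^2 (b - a)]. *)
pose m := (x b - x a) / (b - a).
pose l (t : R) : R := - x a + - m * (t - a).
have mba : m * (b - a) = x b - x a by rewrite /m divfK.
have dl (t : R) : is_derive t (1 : R) l (- m).
  rewrite /l; apply: is_derive_eq.
  by rewrite /GRing.scale/=; ring.
have Pl : primitive a b l (fun _ => - m).
  apply: primitive_continuous => //.
  by apply: continuous_subspaceT => ?; exact: cst_continuous.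
have acl := primitive_ac Pl.
have := wirtinger ab (acD acx acl) (primitiveD Px Pl) (sqintD sx' (cst_sqint a b (- m))).
rewrite /= {1 2}/l => /(_ ltac:(ring)) /(_ ltac:(lra)).
have -> : \int[mu]_(t in `[a, b]) (x t + l t) ^+ 2 = \int[mu]_(t in `[a, b])
     (x t - ((b - t) / (b - a) * x a + (t - a) / (b - a) * x b)) ^+ 2.
  by apply: eq_Rintegral => t _; congr (_ ^+ 2); rewrite /l /m; field.
move=> /le_trans; apply.
have E1 : \int[mu]_(t in `[a, b]) x' t = x b - x a by rewrite (primitive_itv Px)// ltW.
have Ix' := sqint_integrable sx'.
have mI : measurable (`[a, b] : set (measurableTypeR R)) by exact: measurable_itv.
have -> : \int[mu]_(t in `[a, b]) (x' t + - m) ^+ 2 =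
    \int[mu]_(t in `[a, b]) x' t ^+ 2 + (- (2 * m) * \int[mu]_(t in `[a, b]) x' t +
     m ^+ 2 * (b - a)).
  have Ic : mu.-integrable `[a, b] (EFin \o (fun _ => m ^+ 2)).
    by apply: sqint_integrable; exact: cst_sqint.
  rewrite -(RintegralZl _ _ Ix')//.
  have -> : m ^+ 2 * (b - a) = \int[mu]_(t in `[a, b]) m ^+ 2.
    by rewrite Rintegral_cst_itv// ltW.
  rewrite -RintegralD//; last exact: integrable_funZ.
  rewrite -RintegralD//; last 2 first.
  - exact: (proj2 sx').
  - by apply: integrable_funD => //; exact: integrable_funZ.
  by apply: eq_Rintegral => t _; ring.
rewrite E1 -mba; have : 0 <= m ^+ 2 * (b - a) by rewrite mulr_ge0 ?sqr_ge0// subr_ge0 ltW.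
by rewrite -lerBrDl; lra.
Qed.

End SquareIntegrable.

(** * Synthesis operators and their adjoints *)

Section Euclid.
Context {R : realType} (n : nat).
Implicit Types x y z : 'cV[R]_n.

Lemma edotDl x y z : edot (x + y) z = edot x z + edot y z.
Proof. by rewrite /edot -big_split; apply: eq_bigr => i _; rewrite !mxE mulrDl. Qed.

Lemma edot_delta x i : edot x (delta_mx i 0) = x i 0.
Proof.
rewrite /edot (bigD1 i)//= big1 ?addr0; first by rewrite mxE !eqxx mulr1.
by move=> j ji; rewrite mxE (negbTE ji) mulr0.
Qed.

Lemma edot_ge0 x : 0 <= edot x x.
Proof. by apply: sumr_ge0 => i _; rewrite -expr2 sqr_ge0. Qed.

Lemma enorm_ge0 x : 0 <= enorm x. Proof. exact: sqrtr_ge0. Qed.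

Lemma sqr_enorm x : enorm x ^+ 2 = edot x x.
Proof. by rewrite sqr_sqrtr// edot_ge0. Qed.

Lemma sqr_edot_le x y : edot x y ^+ 2 <= edot x x * edot y y.
Proof.
have H z : edot z y <= enorm z * enorm y.
  apply: young_mul; rewrite ?enorm_ge0// => s s0; rewrite !sqr_enorm /edot !mulr_sumr -big_split/=.
  by apply: ler_sum => i _; rewrite -!expr2; exact: young_ineq.
rewrite -!sqr_enorm -exprMn -[leLHS]real_normK ?num_real//.
rewrite ler_sqr ?nnegrE ?mulr_ge0 ?enorm_ge0// ler_norml H andbT.
have := H (- x).
have -> : edot (- x) y = - edot x y.
  by rewrite /edot -sumrN; apply: eq_bigr => i _; rewrite mxE mulNr.
have -> : enorm (- x) = enorm x.
  by congr Num.sqrt; apply: eq_bigr => i _; rewrite mxE mulrNN.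
lra.
Qed.

End Euclid.

(** * Cauchy-Schwarz in L^2 and Riesz representers in H^1_0 *)

Section Adjoint.
Context {R : realType}.
Notation mu := (@lebesgue_measure R).
Implicit Types (f g phi psi : R -> R) (tau : R).

Lemma Rintegral_cauchy_schwarz lo hi f g : sqint lo hi f -> sqint lo hi g ->
  \int[mu]_(t in `[lo, hi]) (f t * g t) <=
  Num.sqrt (\int[mu]_(t in `[lo, hi]) f t ^+ 2) * Num.sqrt (\int[mu]_(t in `[lo, hi]) g t ^+ 2).
Proof.
move=> sf sg; apply: young_mul; rewrite ?sqrtr_ge0// => s s0.
have mI : measurable (`[lo, hi] : set (measurableTypeR R)) by exact: measurable_itv.
have [_ If] := sf; have [_ Ig] := sg; have Ifg := sqintM sf sg.
rewrite !sqr_sqrtr ?Rintegral_sqr_ge0// -(RintegralZl _ _ Ifg)// -(RintegralZl _ _ If)// -(RintegralZl _ _ Ig)//.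
rewrite -RintegralD//; try exact: integrable_funZ.
apply: le_Rintegral => //; first exact: integrable_funZ.
  by apply: integrable_funD => //; exact: integrable_funZ.
by move=> t _; exact: young_ineq.
Qed.

Lemma sqint_eq lo hi f g : {in `[lo, hi], f =1 g} -> sqint lo hi f -> sqint lo hi g.
Proof.
move=> fg [mf If]; split.
  apply: eq_measurable_fun mf => x; rewrite inE => xI; exact: fg.
apply: eq_integrable If => // x; rewrite inE /= => xI; by rewrite fg.
Qed.

Lemma sqint_sum lo hi (I : finType) (F : I -> R -> R) : (forall i, sqint lo hi (F i)) ->
  sqint lo hi (fun t => \sum_i F i t).
Proof.
move=> sF; have H (r : seq I) : sqint lo hi (fun t => \sum_(i <- r) F i t).
  elim: r => [|i r ih].
    by apply: (@sqint_eq _ _ (fun _ => 0)); [move=> t _; rewrite big_nil|exact: cst_sqint].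
  apply: (@sqint_eq _ _ (fun t => F i t + \sum_(i <- r) F i t)); last exact: sqintD.
  by move=> t _; rewrite big_cons.
exact: H.
Qed.

Lemma Rintegral_sum (D : set (measurableTypeR R)) (I : finType) (F : I -> R -> R) : measurable D ->
  (forall i, mu.-integrable D (EFin \o F i)) ->
  \int[mu]_(t in D) (\sum_i F i t) = \sum_i \int[mu]_(t in D) F i t /\
  mu.-integrable D (EFin \o (fun t => \sum_i F i t)).
Proof.
move=> mD iF; have H (r : seq I) :
    \int[mu]_(t in D) (\sum_(i <- r) F i t) = \sum_(i <- r) \int[mu]_(t in D) F i t /\
    mu.-integrable D (EFin \o (fun t => \sum_(i <- r) F i t)).
  elim: r => [|i r [ih1 ih2]].
    split.
      rewrite big_nil; under eq_Rintegral do rewrite big_nil.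
      by rewrite Rintegral_cst// mul0r.
    apply: (eq_integrable mD (cst 0%E)); first by move=> t _; rewrite /= big_nil.
    exact: integrable0.
  split.
    by under eq_Rintegral do rewrite big_cons; rewrite RintegralD// ih1 big_cons.
  apply: (eq_integrable mD (EFin \o (fun t => F i t + \sum_(i <- r) F i t))).
    by move=> t _; rewrite /= big_cons.
  exact: integrable_funD.
exact: H.
Qed.

Lemma lipschitz_abs_cont tau (C : R) f :
  (forall x y, 0 <= x -> x <= y -> y <= tau -> `|f y - f x| <= C * (y - x)) ->
  abs_cont tau (f : R -> R^o).
Proof.
move=> fC e e0; exists (e / (`|C| + 1)); first by rewrite divr_gt0// ltr_wpDl.
move=> m a b ab _; rewrite ltr_pdivlMr ?ltr_wpDl// => sd.
apply: le_lt_trans sd; rewrite mulr_suml.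
apply: ler_sum => i _; have [p0 p12 pt] := ab i; rewrite (le_trans (fC _ _ _ _ _))//.
rewrite mulrC ler_wpM2l ?subr_ge0// (le_trans (ler_norm _))//; lra.
Qed.

Lemma H10_primitive tau phi : 0 < tau -> H10 tau phi ->
  [/\ ac 0 tau phi, sqint 0 tau (derive1 phi), primitive 0 tau phi (derive1 phi),
     phi 0 = 0 & phi tau = 0].
Proof.
move=> tau0 [acphi Lphi phi0 phit].
have a : ac 0 tau phi by apply: (@abs_cont_ac _ _ tau id phi).
have s : sqint 0 tau (derive1 phi) by exact/L2_sqint.
by split => //; apply: ac_primitive_derive1 => //; case: s.
Qed.

Lemma Rintegral_is_derive (p : R -> R) (a x u : R) : a < x -> x < u ->
  mu.-integrable `[a, u] (EFin \o p) -> {for x, continuous p} ->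
  is_derive x (1 : R) (fun t => \int[mu]_(s in `[a, t]) p s) (p x).
Proof.
move=> ax xu ip cp; have [dF dFE] := continuous_FTC1_closed xu ip ax cp.
by apply: DeriveDef; [exact: dF|rewrite -derive1E].
Qed.

(* The representer solves [psi'' = - g] with [psi 0 = psi tau = 0]. It is built on a
   neighbourhood of [0, tau] so that its two-sided derivative is known at the end points too. *)
Lemma H10_representer tau g : 0 < tau -> sqint 0 tau g ->
  exists psi, H10 tau psi /\ forall phi, H10 tau phi ->
    \int[mu]_(t in `[0, tau]) (phi t * g t) = H10_inner tau phi psi.
Proof.
move=> tau0 sg; have ig := sqint_integrable sg.
pose r := g \_ `[0, tau].
have ir : mu.-integrable setT (EFin \o r).
  by rewrite /r -restrict_EFin -integrable_mkcond.
have irI (a b : R) : mu.-integrable `[a, b] (EFin \o r) by apply: integrableS ir.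
(* The lower limits -2 here and -1 in [F] are nested margins: [A] is continuous around the domain of
   [F], and 0 and tau are interior to that domain. *)
pose A (t : R) : R := \int[mu]_(u in `[(-2), t]) r u.
have cA : {within `[(-2), (tau + 2)], continuous A}.
  by apply: parameterized_integral_continuous => //; lra.
have cA' (t : R) : -2 < t -> t < tau + 2 -> {for t, continuous A}.
  move=> t1 t2; have /continuous_within_itvP := cA.
  by move=> /(_ ltac:(lra))[h _ _]; apply: h; rewrite in_itv/= t1.
(* With the mean of [A] over [0, tau] as constant, [p = C - A] has integral zero there, which gives
   [psi tau = 0]. *)
pose C := (\int[mu]_(t in `[0, tau]) A t) / tau.
pose p (t : R) : R := C - A t.
have cp (t : R) : -2 < t -> t < tau + 2 -> {for t, continuous p}.
  move=> t1 t2; apply: (@continuousB _ _ _ (cst C) A); first exact: cst_continuous.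
  exact: cA'.
have cpI (a b : R) : -2 < a -> b < tau + 2 -> {within `[a, b], continuous p}.
  move=> a2 b2; apply: continuous_in_subspaceT => t; rewrite inE/= in_itv/= => /andP[ta tb].
  by apply: cp; lra.
have ip (a b : R) : -2 < a -> b < tau + 2 -> mu.-integrable `[a, b] (EFin \o p).
  by move=> a2 b2; apply: sqint_integrable; apply: continuous_sqint; exact: cpI.
pose F (t : R) : R := \int[mu]_(u in `[(-1), t]) p u.
pose psi (t : R) : R := - F 0 + F t.
have dpsi (t : R) : 0 <= t -> t <= tau -> is_derive t (1 : R) psi (p t).
  move=> t0 tt; have ip1 : mu.-integrable `[(-1), (tau + 1)] (EFin \o p) by apply: ip; lra.
  have cpt : {for t, continuous p} by apply: cp; lra.
  have t1 : -1 < t by lra.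
  have t2 : t < tau + 1 by lra.
  have dF1 : is_derive t (1 : R) F (p t) := Rintegral_is_derive t1 t2 ip1 cpt.
  by have := is_deriveD (is_derive_cst (- F 0) t 1) dF1; rewrite add0r.
have Ppsi : primitive 0 tau psi p.
  by apply: primitive_continuous => //; apply: cpI; lra.
have psi0 : psi 0 = 0 by rewrite /psi addNr.
have psit : psi tau = 0.
  have [_ /(_ tau (ltW tau0) (lexx _))] := Ppsi; rewrite psi0 add0r => ->.
  rewrite RintegralB//; last 2 first.
  - by apply: sqint_integrable; exact: cst_sqint.
  - apply: sqint_integrable; apply: continuous_sqint; apply: continuous_subspaceW cA.
    by apply: subset_itv; rewrite bnd_simp; lra.
  by rewrite Rintegral_cst_itv ?ltW// subr0 /C divfK ?subrr// gt_eqF.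
have dE : {in `[0, tau], p =1 derive1 psi}.
  move=> t; rewrite in_itv/= => /andP[t0 tt].
  by rewrite derive1E; have [_ ->] := dpsi t t0 tt.
have sp : sqint 0 tau p by apply: continuous_sqint; apply: cpI; lra.
have [B B0 pB] := within_continuous_bounded (ltW tau0) (cpI 0 tau ltac:(lra) ltac:(lra)).
exists psi; split.
  split => //; last by apply/L2_sqint; exact: sqint_eq dE sp.
  apply: (@lipschitz_abs_cont _ B) => x y x0 xy yt.
  have ipxy : mu.-integrable `[x, y] (EFin \o p) by apply: ip; lra.
  rewrite (primitive_itv Ppsi)// (le_trans (le_normr_Rintegral _ ipxy))//.
  rewrite -Rintegral_cst_itv//; apply: le_Rintegral => //.
  - exact: integrable_norm.
  - by apply: sqint_integrable; exact: cst_sqint.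
  - by move=> t; rewrite /= in_itv/= => /andP[tx ty]; apply: pB; lra.
move=> phi /(H10_primitive tau0)[acphi sphi Pphi phi0 phit].
have Pp : primitive 0 tau p (fun t => -1 * g t).
  split; first exact: integrable_funZ.
  move=> t t0 tt; rewrite RintegralZl//; last by apply: integrable_subseg ig.
  rewrite /p /A (@Rintegral_itv_cat _ r (-2) 0 t ltac:(lra) t0 (irI _ _)).
  rewrite (@eq_Rintegral _ _ _ mu _ r g); first ring.
  move=> u; rewrite inE/= in_itv/= => /andP[u0 ut].
  by rewrite /r patchE mem_set//= in_itv/=; lra.
have := Rintegral_by_parts_ac tau0 acphi (primitive_ac Pp) Pphi Pp.
rewrite phi0 phit !mul0r subr0 sub0r => E.
have I : mu.-integrable `[0, tau] (EFin \o (fun t => phi t * g t)) by exact: ac_integrable_mul.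
have mI : measurable (`[0, tau] : set (measurableTypeR R)) by exact: measurable_itv.
have E1 := RintegralZl (-1) mI I.
have E2 : \int[mu]_(t in `[0, tau]) (phi t * (-1 * g t)) =
    -1 * \int[mu]_(t in `[0, tau]) (phi t * g t).
  by apply: etrans E1; apply: eq_Rintegral => t _; ring.
have := etrans (esym E2) E; rewrite mulN1r => /oppr_inj ->.
by apply: eq_Rintegral => t; rewrite inE /= => tI; rewrite mulrC dE.
Qed.

End Adjoint.

Section Synthesis.
Context {R : realType} (n : nat).
Notation mu := (@lebesgue_measure R).
Implicit Types (f : R -> 'cV[R]_n) (phi psi : R -> R) (tau : R).

Lemma L2vec_edot_sqint tau f y : L2vec tau f -> sqint 0 tau (fun t => edot (f t) y).
Proof.
move=> Lf; apply: sqint_sum => i.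
apply: (@sqint_eq _ _ _ (fun t => y i 0 * f t i 0)); first by move=> t _; rewrite mulrC.
by apply: sqintZ; apply/L2_sqint; exact: Lf.
Qed.

Lemma edot_synthesis tau f phi y : L2vec tau f -> sqint 0 tau phi ->
  edot (synthesis tau f phi) y = \int[mu]_(t in `[0, tau]) (phi t * edot (f t) y).
Proof.
move=> Lf sphi.
have sf i : sqint 0 tau (fun t => f t i 0) by apply/L2_sqint; exact: Lf.
have I i : mu.-integrable `[0, tau] (EFin \o (fun t => phi t * f t i 0)) by exact: sqintM.
have I' i : mu.-integrable `[0, tau] (EFin \o (fun t => y i 0 * (phi t * f t i 0))).
  exact: integrable_funZ.
have [E _] := Rintegral_sum (measurable_itv _) I'.
transitivity (\int[mu]_(t in `[0, tau]) (\sum_(i < n) y i 0 * (phi t * f t i 0))); last first.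
  by apply: eq_Rintegral => t _; rewrite /edot mulr_sumr; apply: eq_bigr => i _; ring.
rewrite E; apply: eq_bigr => i _.
by rewrite mxE RintegralZl// mulrC.
Qed.

(** The choice in [adjoint] is sound as soon as some adjoint exists. One is obtained by choosing,
    for each [y], a representer of the functional that integrates [phi] against [edot (f t) y]. *)
Lemma synthesis_adjointP tau f : 0 < tau -> L2vec tau f ->
  is_adjoint tau (synthesis tau f) (adjoint tau (synthesis tau f)).
Proof.
move=> tau0 Lf; apply: (@xgetPex _ _ [set G | is_adjoint tau (synthesis tau f) G]).
have /choice[G HG] : forall y : 'cV[R]_n, exists psi, H10 tau psi /\ forall phi, H10 tau phi ->
    \int[mu]_(t in `[0, tau]) (phi t * edot (f t) y) = H10_inner tau phi psi.
  by move=> y; apply: H10_representer => //; exact: L2vec_edot_sqint.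
exists G => y; have [HGy E] := HG y; split => // phi Hphi.
have [aphi _ _ _ _] := H10_primitive tau0 Hphi.
by rewrite edot_synthesis// ?E//; exact: ac_sqint.
Qed.

Lemma H10_innerC tau phi psi : H10_inner tau phi psi = H10_inner tau psi phi.
Proof. by apply: eq_Rintegral => t _; rewrite mulrC. Qed.

Lemma H10_inner_ge0 tau phi : 0 <= H10_inner tau phi phi.
Proof. by apply: Rintegral_ge0 => t _; rewrite -expr2 sqr_ge0. Qed.

Lemma H10_cauchy_schwarz tau phi psi : 0 < tau -> H10 tau phi -> H10 tau psi ->
  H10_inner tau phi psi <=
  Num.sqrt (H10_inner tau phi phi) * Num.sqrt (H10_inner tau psi psi).
Proof.
move=> tau0 /(H10_primitive tau0)[_ s1 _ _ _] /(H10_primitive tau0)[_ s2 _ _ _].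
exact: Rintegral_cauchy_schwarz.
Qed.

(** * The quadratic form of the matrix and operator bounds *)

Section QuadraticForm.
Context (tau : R) (F : (R -> R) -> 'cV[R]_n).
Context (adjF : is_adjoint tau F (adjoint tau F)).
Let G := adjoint tau F.

Let H10G y : H10 tau (G y). Proof. by have [] := adjF y. Qed.
Let FG y phi : H10 tau phi -> edot (F phi) y = H10_inner tau phi (G y).
Proof. by have [_ ] := adjF y; apply. Qed.

Lemma FFadj_sym : (FFadj tau F)^T = FFadj tau F.
Proof.
apply/matrixP => i j; rewrite !mxE -[LHS]edot_delta -[RHS]edot_delta.
rewrite (FG (delta_mx j 0) (H10G (delta_mx i 0))) (FG (delta_mx i 0) (H10G (delta_mx j 0))).
exact: H10_innerC.
Qed.

(** The matrix is known through the values [G e_j] only. By the adjoint identity and symmetry, [(F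
    (G y))_j = <G y, G e_j> = <F (G e_j), y>], so no linearity of [G] has to be established. *)
Lemma FFadj_form y : (y^T *m FFadj tau F *m y) 0 0 = H10_inner tau (G y) (G y).
Proof.
rewrite mxE -(FG y (H10G y)); apply: eq_bigr => j _; congr (_ * _).
rewrite -[RHS]edot_delta (FG _ (H10G y)) H10_innerC -(FG _ (H10G _)) mxE /edot.
by apply: eq_bigr => i _; rewrite !mxE mulrC.
Qed.

Lemma FFadj_loewnerP c : loewner_le (FFadj tau F) c%:M <->
  forall y, H10_inner tau (G y) (G y) <= c * edot y y.
Proof.
have E y : (y^T *m (c%:M - FFadj tau F) *m y) 0 0 = c * edot y y - H10_inner tau (G y) (G y).
  rewrite mulmxBr mulmxBl mxE [X in _ + X]mxE FFadj_form; congr (_ - _).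
  rewrite mul_mx_scalar -scalemxAl mxE mxE; congr (_ * _).
  by apply: eq_bigr => i _; rewrite mxE.
split=> [[_ H] y|H]; first by have := H y; rewrite E subr_ge0.
split; last by move=> y; rewrite E subr_ge0.
rewrite qualifE /= expr0 scale1r map_mx_id//.
by rewrite linearB/= tr_scalar_mx FFadj_sym.
Qed.

(** Testing with [phi = G y] gives [|G y|^2 <= K |y| |G y|]; divide by [|G y|] unless it
    vanishes. *)
Lemma loewner_le_of_bound (K : R) : 0 <= K ->
  (forall phi y, H10 tau phi ->
    edot (F phi) y <= K * enorm y * Num.sqrt (H10_inner tau phi phi)) ->
  loewner_le (FFadj tau F) (K ^+ 2)%:M.
Proof.
move=> K0 H; apply/FFadj_loewnerP => y.
have := H _ y (H10G y); rewrite (FG y (H10G y)).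
set N := H10_inner _ _ _; have N0 : 0 <= N by exact: H10_inner_ge0.
rewrite -{1}(sqr_sqrtr N0) -sqr_enorm -exprMn => h.
have s0 := sqrtr_ge0 N; have y0 := enorm_ge0 y.
rewrite -[leLHS](sqr_sqrtr N0).
have Ky0 : 0 <= K * enorm y by rewrite mulr_ge0.
rewrite ler_sqr ?nnegrE//.
have [->//|sn0] := eqVneq (Num.sqrt N) 0.
by rewrite -(ler_pM2r (_ : 0 < Num.sqrt N)) ?lt_def ?sn0// -expr2.
Qed.

(** Turns the matrix hypothesis on [v] into a bound on [<V phi, y>]. Such bounds add up when the
    functions defining the operators are added, whereas the matrices do not. *)
Lemma bound_of_loewner_le (K : R) : 0 < tau -> 0 <= K ->
  loewner_le (FFadj tau F) (K ^+ 2)%:M ->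
  forall phi y, H10 tau phi ->
    edot (F phi) y <= K * enorm y * Num.sqrt (H10_inner tau phi phi).
Proof.
move=> tau0 K0 /FFadj_loewnerP H phi y Hphi.
rewrite (FG y Hphi); apply: (le_trans (H10_cauchy_schwarz tau0 Hphi (H10G y))).
rewrite mulrC.
apply: ler_wpM2r; first exact: sqrtr_ge0.
rewrite -[leRHS]ger0_norm ?mulr_ge0 ?enorm_ge0// -sqrtr_sqr ler_sqrt.
  by rewrite exprMn sqr_enorm.
by rewrite sqr_ge0.
Qed.

End QuadraticForm.

Lemma L2norm_sqrt tau f : L2vec tau f ->
  L2norm tau f = Num.sqrt (\int[mu]_(t in `[0, tau]) edot (f t) (f t)).
Proof.
move=> Lf.
have sf i : sqint 0 tau (fun t => f t i 0) by apply/L2_sqint; exact: Lf.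
have mI : measurable (`[0, tau] : set (measurableTypeR R)) by exact: measurable_itv.
have [_ Ie] := Rintegral_sum mI (fun i => sqintM (sf i) (sf i)).
rewrite /L2norm unlock.
have -> : (\int[mu]_x `|(EFin \o (fun t => enorm (f t)) \_ `[0%R, tau]) x| `^ 2 =
    \int[mu]_(x in `[0%R, tau]) (edot (f x) (f x))%:E)%E.
  rewrite [RHS]integral_mkcond; apply: eq_integral => x _ /=.
  rewrite !patchE; case: ifPn => _ /=; last by rewrite normr0 powR0.
  by rewrite powR_mulrn// ger0_norm ?enorm_ge0// sqr_enorm.
have fin : (\int[mu]_(x in `[0%R, tau]) (edot (f x) (f x))%:E)%E \is a fin_num.
  exact: integrable_fin_num Ie.
rewrite -(fineK fin) poweR_EFin /= powR12_sqrt//.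
by apply: fine_ge0; apply: integral_ge0 => x _; rewrite lee_fin edot_ge0.
Qed.

End Synthesis.

(** * Interpolation error *)

Section Interpolation.
Context {R : realType}.
Notation mu := (@lebesgue_measure R).

Lemma affine_sqint lo hi (c1 c2 : R) : sqint lo hi (fun t => c1 + c2 * t).
Proof.
apply: sqintD; first exact: cst_sqint.
by apply: sqintZ; apply: continuous_sqint; apply: continuous_subspaceT => t; exact: cvg_id.
Qed.

(** The error is [w - d], with [w] the noise-free interpolation error and [d] the interpolated
    noise. [d] is a convex combination of [da] and [db], hence at most [D] in absolute value, and
    [w] is controlled by the Wirtinger inequality. The parameter [s] stays free so that the estimate
    can be summed. *)
Lemma noisy_interpolation_error_itv (a b h s D da db : R) (x x' xb : R -> R) : a < b -> b - a <= h -> 0 < s ->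
  ac a b x -> primitive a b x x' -> sqint a b x' -> sqint a b xb ->
  `|da| <= D -> `|db| <= D ->
  (forall u, a <= u -> u <= b ->
    xb u = (b - u) / (b - a) * (x a + da) + (u - a) / (b - a) * (x b + db)) ->
  \int[mu]_(u in `[a, b]) (x u - xb u) ^+ 2 <=
  (1 + s) * ((h / pi) ^+ 2 * \int[mu]_(u in `[a, b]) x' u ^+ 2) + (1 + s^-1) * (D ^+ 2 * (b - a)).
Proof.
move=> ab bah s0 acx Px sx' sxb aD bD xbE.
have ba : 0 < b - a by lra.
have ban0 : b - a != 0 by rewrite gt_eqF.
have pi0 := pi_gt0 R.
have D0 : 0 <= D by apply: le_trans aD.
have si : 0 < s^-1 by rewrite invr_gt0.
have mI : measurable (`[a, b] : set (measurableTypeR R)) by exact: measurable_itv.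
pose w u := x u - ((b - u) / (b - a) * x a + (u - a) / (b - a) * x b).
pose d u := (b - u) / (b - a) * da + (u - a) / (b - a) * db.
have sw : sqint a b w.
  apply: sqintB; first exact: ac_sqint.
  apply: (@sqint_eq _ _ _ (fun u => (b * x a - a * x b) / (b - a) + (x b - x a) / (b - a) * u)).
    by move=> u _; field.
  exact: affine_sqint.
have Iw : \int[mu]_(u in `[a, b]) w u ^+ 2 <= (h / pi) ^+ 2 * \int[mu]_(u in `[a, b]) x' u ^+ 2.
  have := linear_interpolation_error ab acx Px sx'; rewrite -/(w _).
  set I := Rintegral _ _ _; set J := Rintegral _ _ _ => H.
  have J0 : 0 <= J by exact: Rintegral_sqr_ge0.
  have {}H : I <= ((b - a) / pi) ^+ 2 * J.
    rewrite -(@ler_pM2l _ ((pi / (b - a)) ^+ 2)); last by rewrite exprn_gt0// divr_gt0.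
    apply: (le_trans H); rewrite mulrA -exprMn mulrA divfK// divff ?gt_eqF// expr1n mul1r//.
  apply: (le_trans H); apply: ler_wpM2r => //.
  rewrite ler_sqr ?nnegrE ?divr_ge0//; try lra.
  by apply: ler_wpM2r => //; rewrite invr_ge0 ltW.
have key u : `[a, b]%classic u -> (x u - xb u) ^+ 2 <= (1 + s) * w u ^+ 2 + (1 + s^-1) * D ^+ 2.
  rewrite /= in_itv/= => /andP[au ub].
  have -> : x u - xb u = w u + - d u by rewrite xbE// /w /d; ring.
  have dD : d u ^+ 2 <= D ^+ 2.
    rewrite -[leLHS]real_normK ?num_real// ler_sqr ?nnegrE//.
    have l1 : 0 <= (b - u) / (b - a) by rewrite divr_ge0; lra.
    have l2 : 0 <= (u - a) / (b - a) by rewrite divr_ge0; lra.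
    apply: (le_trans (ler_normD _ _)).
    rewrite (normrM ((b - u) / (b - a))) (normrM ((u - a) / (b - a))) (ger0_norm l1) (ger0_norm l2).
    apply: (@le_trans _ _ ((b - u) / (b - a) * D + (u - a) / (b - a) * D)).
      by apply: lerD; apply: ler_wpM2l.
    by rewrite le_eqVlt; apply/orP; left; apply/eqP; field.
  have Y : 2 * (w u * - d u) <= s * w u ^+ 2 + s^-1 * d u ^+ 2.
    by rewrite -(sqrrN (d u)); exact: young_ineq.
  have : s^-1 * d u ^+ 2 <= s^-1 * D ^+ 2 by apply: ler_wpM2l => //; rewrite ltW.
  have -> : (w u + - d u) ^+ 2 = w u ^+ 2 + 2 * (w u * - d u) + d u ^+ 2 by ring.
  move: dD Y; generalize (w u * - d u) (w u ^+ 2) (d u ^+ 2) (D ^+ 2) => p1 p2 p3 p4.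
  by move=> *; lra.
have I1 : mu.-integrable `[a, b] (EFin \o (fun u => (1 + s) * w u ^+ 2)).
  by apply: integrable_funZ => //; case: sw.
have I2 : mu.-integrable `[a, b] (EFin \o (fun=> (1 + s^-1) * D ^+ 2)).
  by apply: sqint_integrable; exact: cst_sqint.
have I3 : mu.-integrable `[a, b] (EFin \o (fun u => (x u - xb u) ^+ 2)).
  by case: (sqintB (ac_sqint ab acx) sxb).
apply: (le_trans (le_Rintegral mI I3 (integrable_funD mI I1 I2) key)).
rewrite (RintegralD mI I1 I2) (RintegralZl _ mI (proj2 sw)) (Rintegral_cst_itv _ (ltW ab)).
apply: lerD; last by rewrite le_eqVlt; apply/orP; left; apply/eqP; ring.
by apply: ler_wpM2l => //; lra.
Qed.

(** For fixed [s] both sides are additive over adjacent intervals, so induction on [N] suffices. [h]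
    is any common bound on the steps, so it does not change when the last interval is removed. *)
Lemma noisy_interpolation_error (N : nat) (t : nat -> R) (h s D : R) (delta : nat -> R)
    (x x' xb : R -> R) : 0 < s -> 0 <= D ->
  (forall l, (l < N)%N -> t l < t l.+1) -> (forall l, (l < N)%N -> t l.+1 - t l <= h) ->
  ac (t 0%N) (t N) x -> primitive (t 0%N) (t N) x x' ->
  sqint (t 0%N) (t N) x' -> sqint (t 0%N) (t N) xb ->
  (forall l, (l <= N)%N -> `|delta l| <= D) ->
  (forall l u, (l < N)%N -> t l <= u -> u <= t l.+1 ->
    xb u = (t l.+1 - u) / (t l.+1 - t l) * (x (t l) + delta l) +
           (u - t l) / (t l.+1 - t l) * (x (t l.+1) + delta l.+1)) ->
  \int[mu]_(u in `[t 0%N, t N]) (x u - xb u) ^+ 2 <=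
  (1 + s) * ((h / pi) ^+ 2 * \int[mu]_(u in `[t 0%N, t N]) x' u ^+ 2) +
  (1 + s^-1) * (D ^+ 2 * (t N - t 0%N)).
Proof.
move=> s0 D0; elim: N => [|N ih] tinc th acx Px sx' sxb dD xbE.
  by rewrite !set_itv1 !Rintegral_set1 subrr !mulr0 addr0.
have t0N : t 0%N <= t N.
  have : forall k, (k <= N)%N -> t 0%N <= t k.
    elim=> // k ihk kN; rewrite (le_trans (ihk (ltnW kN)))// ltW// tinc//.
    by rewrite ltnS ltnW.
  exact.
have tNN := tinc N (ltnSn N).
have NN := ltW tNN.
have sx : sqint (t 0%N) (t N.+1) x by apply: ac_sqint => //; exact: le_lt_trans tNN.
rewrite (Rintegral_itv_cat t0N NN (proj2 (sqintB sx sxb))) (Rintegral_itv_cat t0N NN (proj2 sx')).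
have h1 := ih (fun l lN => tinc l (ltnW lN)) (fun l lN => th l (ltnW lN))
  (ac_sub_itv (lexx _) NN acx) (primitive_sub (lexx _) NN Px) (sqint_sub (lexx _) NN sx')
  (sqint_sub (lexx _) NN sxb) (fun l lN => dD l (leqW lN)) (fun l u lN => xbE l u (ltnW lN)).
have h2 := noisy_interpolation_error_itv tNN (th N (ltnSn N)) s0
  (ac_sub_itv t0N (lexx _) acx) (primitive_sub t0N (lexx _) Px) (sqint_sub t0N (lexx _) sx')
  (sqint_sub t0N (lexx _) sxb) (dD N (leqnSn N)) (dD N.+1 (leqnn _)) (fun u => xbE N u (ltnSn N)).
apply: (le_trans (lerD h1 h2)).
by rewrite le_eqVlt; apply/orP; left; apply/eqP; ring.
Qed.

End Interpolation.

(** * Vector-valued functions *)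

Section Vector.
Context {R : realType} (n : nat).
Notation mu := (@lebesgue_measure R).
Implicit Types (f g x : R -> 'cV[R]_n) (tau : R).

Lemma L2vecP tau f : L2vec tau f <-> forall i, sqint 0 tau (fun t => f t i 0).
Proof. by split => H i; apply/L2_sqint; exact: H. Qed.

Lemma L2vecD tau f g : L2vec tau f -> L2vec tau g -> L2vec tau (fun t => f t + g t).
Proof.
move=> /L2vecP Lf /L2vecP Lg; apply/L2vecP => i.
by apply: sqint_eq (sqintD (Lf i) (Lg i)) => t _; rewrite mxE.
Qed.

Lemma L2vecB tau f g : L2vec tau f -> L2vec tau g -> L2vec tau (fun t => f t - g t).
Proof.
move=> /L2vecP Lf /L2vecP Lg; apply/L2vecP => i.
by apply: sqint_eq (sqintB (Lf i) (Lg i)) => t _; rewrite !mxE.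
Qed.

Lemma L2norm_ge0 tau f : 0 <= L2norm tau f.
Proof. by apply: fine_ge0; exact: Lnorm_ge0. Qed.

Lemma integrable_edot tau f : L2vec tau f ->
  mu.-integrable `[0, tau] (EFin \o (fun t => edot (f t) (f t))).
Proof.
move=> /L2vecP sf; have mI : measurable (`[0, tau] : set (measurableTypeR R)) by exact: measurable_itv.
by have [_] := Rintegral_sum mI (fun i => sqintM (sf i) (sf i)).
Qed.

Lemma L2norm_sqr tau f : L2vec tau f ->
  L2norm tau f ^+ 2 = \int[mu]_(t in `[0, tau]) edot (f t) (f t).
Proof.
move=> Lf; rewrite L2norm_sqrt// sqr_sqrtr//.
by apply: Rintegral_ge0 => t _; exact: edot_ge0.
Qed.

Lemma L2norm_sqr_sum tau f : L2vec tau f ->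
  L2norm tau f ^+ 2 = \sum_(i < n) \int[mu]_(t in `[0, tau]) f t i 0 ^+ 2.
Proof.
move=> Lf; rewrite L2norm_sqr//; move/L2vecP: Lf => sf.
have mI : measurable (`[0, tau] : set (measurableTypeR R)) by exact: measurable_itv.
by have [] := Rintegral_sum mI (fun i => sqintM (sf i) (sf i)).
Qed.

Lemma L2norm_triangle tau f g : L2vec tau f -> L2vec tau g ->
  L2norm tau (fun t => f t + g t) <= L2norm tau f + L2norm tau g.
Proof.
move=> Lf Lg; have f0 := L2norm_ge0 tau f; have g0 := L2norm_ge0 tau g.
rewrite -ler_sqr ?nnegrE ?addr_ge0 ?L2norm_ge0//; apply: young_sqr => // s s0.
rewrite (L2norm_sqr_sum (L2vecD Lf Lg)) !L2norm_sqr_sum// !mulr_sumr -big_split/=.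
move/L2vecP: Lf => sf; move/L2vecP: Lg => sg.
apply: ler_sum => i _; have mI : measurable (`[0, tau] : set (measurableTypeR R)) by exact: measurable_itv.
have I1 := integrable_funZ (1 + s) mI (proj2 (sf i)).
have I2 := integrable_funZ (1 + s^-1) mI (proj2 (sg i)).
rewrite -(RintegralZl _ mI (proj2 (sf i))) -(RintegralZl _ mI (proj2 (sg i))).
rewrite -(RintegralD mI I1 I2); apply: (le_Rintegral mI) => //.
- have := proj2 (sqintD (sf i) (sg i)).
  by apply: (eq_integrable mI) => t _; rewrite /= mxE.
- exact: integrable_funD.
- by move=> t _; rewrite mxE sqrrD; have := young_ineq (f t i 0) (g t i 0) s0; lra.
Qed.

Lemma L2_edot_le tau f y : L2vec tau f ->
  Num.sqrt (\int[mu]_(t in `[0, tau]) edot (f t) y ^+ 2) <= L2norm tau f * enorm y.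
Proof.
move=> Lf; have mI : measurable (`[0, tau] : set (measurableTypeR R)) by exact: measurable_itv.
rewrite -[leRHS]ger0_norm ?mulr_ge0 ?L2norm_ge0 ?enorm_ge0// -sqrtr_sqr ler_sqrt ?sqr_ge0//.
have Ie := integrable_edot Lf.
rewrite exprMn sqr_enorm L2norm_sqr// mulrC -(RintegralZl _ mI Ie).
apply: (le_Rintegral mI).
- by case: (L2vec_edot_sqint y Lf).
- exact: integrable_funZ.
- by move=> t _; rewrite mulrC; exact: sqr_edot_le.
Qed.

(** [derive1 x] is taken for the vector-valued function and equals the vector of coordinate
    derivatives where all coordinates are differentiable at once; the exceptional set is a finite
    union of null sets. *)
Lemma H1vec_component tau x i : 0 < tau -> H1vec tau x ->
  [/\ ac 0 tau (fun t => x t i 0),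
     primitive 0 tau (fun t => x t i 0) (fun t => derive1 x t i 0) &
     sqint 0 tau (fun t => derive1 x t i 0)].
Proof.
move=> tau0 [acx /L2vecP sx'].
have acxi j : ac 0 tau (fun t => x t j 0).
  apply: (@abs_cont_ac _ _ tau (fun v : 'cV[R]_n => v j 0) x) => // u v.
  rewrite [leRHS]/Num.Def.normr/= mx_normrE.
  by apply: le_trans (le_bigmax _ _ (j, ord0)); rewrite !mxE.
have [rho int H] := ac_density tau0 (acxi i).
have P : primitive 0 tau (fun t => x t i 0) rho.
  by split => //; apply: integrableS int.
split => //; apply: (primitive_ae P); first by case: (sx' i).
have D : {ae mu, forall t, forall j, 0 < t < tau -> derivable (fun t => x t j 0) t 1}.
  by apply: filter_forall => j; exact: ac_derivable.
have := primitive_is_derive P; apply: filterS2 D => t D d tt.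
have dx : derivable x t 1.
  by apply/derivable_mxP => j k; rewrite (ord1 k); exact: D.
rewrite derive1E (derive_mx dx) mxE.
by have [_ ->] := d tt.
Qed.

Lemma H1vec_L2vec tau x : 0 < tau -> H1vec tau x -> L2vec tau x.
Proof.
move=> tau0 Hx; apply/L2vecP => i; have [a _ _] := H1vec_component i tau0 Hx.
exact: ac_sqint.
Qed.

Lemma synthesis_bound tau f phi y : 0 < tau -> L2vec tau f -> H10 tau phi ->
  edot (synthesis tau f phi) y <=
  (tau / pi * L2norm tau f) * enorm y * Num.sqrt (H10_inner tau phi phi).
Proof.
move=> tau0 Lf Hphi.
have [aphi sphi' Pphi phi0 phit] := H10_primitive tau0 Hphi.
have sphi := ac_sqint tau0 aphi.
rewrite (edot_synthesis _ Lf sphi).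
apply: (le_trans (Rintegral_cauchy_schwarz sphi (L2vec_edot_sqint y Lf))).
have -> : tau / pi * L2norm tau f * enorm y * Num.sqrt (H10_inner tau phi phi) =
  (tau / pi * Num.sqrt (H10_inner tau phi phi)) * (L2norm tau f * enorm y) by ring.
apply: ler_pM; rewrite ?sqrtr_ge0//; last exact: L2_edot_le.
have pi0 := pi_gt0 R.
have tp0 : 0 <= tau / pi by rewrite divr_ge0 ?ltW.
rewrite -{1}(ger0_norm tp0) -sqrtr_sqr -sqrtrM ?sqr_ge0// ler_sqrt; last first.
  by rewrite mulr_ge0 ?sqr_ge0 ?H10_inner_ge0.
have := wirtinger tau0 aphi Pphi sphi' phi0 phit; rewrite subr0 => W.
rewrite -(@ler_pM2l _ ((pi / tau) ^+ 2)); last by rewrite exprn_gt0// divr_gt0.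
apply: (le_trans W); rewrite mulrA -exprMn mulrA divfK ?gt_eqF// divff ?gt_eqF// expr1n mul1r.
by rewrite /H10_inner; under [leRHS]eq_Rintegral do rewrite -expr2.
Qed.

(** [f'] is a separate argument: in the application it is [derive1 x - derive1 xbar], a density of
    [x - xbar] that need not coincide everywhere with its [derive1]. The boundary terms vanish with
    [phi], and the sign is absorbed into the derivative of [phi]. *)
Lemma synthesis_derive_bound tau f f' phi y : 0 < tau -> L2vec tau f -> L2vec tau f' ->
  (forall i, ac 0 tau (fun t => f t i 0)) ->
  (forall i, primitive 0 tau (fun t => f t i 0) (fun t => f' t i 0)) -> H10 tau phi ->
  edot (synthesis tau f' phi) y <=
  L2norm tau f * enorm y * Num.sqrt (H10_inner tau phi phi).
Proof.
move=> tau0 Lf Lf' acf Pf Hphi.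
have [aphi sphi' Pphi phi0 phit] := H10_primitive tau0 Hphi.
have sphi := ac_sqint tau0 aphi.
rewrite (edot_synthesis _ Lf' sphi).
have Pe : primitive 0 tau (fun t => edot (f t) y) (fun t => edot (f' t) y).
  have H (r : seq 'I_n) : primitive 0 tau (fun t => \sum_(i <- r) f t i 0 * y i 0)
      (fun t => \sum_(i <- r) f' t i 0 * y i 0).
    elim: r => [|i r ih].
      under eq_fun do rewrite big_nil; under [X in primitive _ _ _ X]eq_fun do rewrite big_nil.
      apply: primitive_continuous => //.
      by apply: continuous_subspaceT => ?; exact: cst_continuous.
    under eq_fun do rewrite big_cons; under [X in primitive _ _ _ X]eq_fun do rewrite big_cons.
    apply: primitiveD => //; have := primitiveZ (y i 0) (Pf i).
    by under eq_fun do rewrite mulrC; under [X in primitive _ _ _ X]eq_fun do rewrite mulrC.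
  exact: H.
have := Rintegral_by_parts_ac tau0 aphi (primitive_ac Pe) Pphi Pe.
rewrite phi0 phit !mul0r subr0 sub0r => ->.
have mI : measurable (`[0, tau] : set (measurableTypeR R)) by exact: measurable_itv.
have sNphi : sqint 0 tau (fun t => -1 * derive1 phi t) by exact: sqintZ.
have se := L2vec_edot_sqint y Lf.
have E1 := RintegralZl (-1) mI (sqintM se sphi').
rewrite -mulN1r.
have E2 : -1 * \int[mu]_(t in `[0, tau]) (edot (f t) y * phi^`()%classic t) =
  \int[mu]_(t in `[0, tau]) (-1 * derive1 phi t * edot (f t) y).
  by apply: etrans (esym E1) _; apply: eq_Rintegral => t _; ring.
rewrite E2; apply: (le_trans (Rintegral_cauchy_schwarz sNphi se)).
rewrite mulrC; apply: ler_pM; rewrite ?sqrtr_ge0//; first exact: L2_edot_le.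
rewrite le_eqVlt; apply/orP; left; apply/eqP; congr Num.sqrt.
by apply: eq_Rintegral => t _; ring.
Qed.

End Vector.

(** * Bounds for the sampling error and the two matrix inequalities *)

Unset Implicit Arguments.
Set Strict Implicit.
Set Printing Implicit Defensive.

Theorem theorem4p6 (R : realType) (n N : nat) (tau : R)
  (n_gt0 : (0 < n)%N) (N_gt0 : (0 < N)%N) (tau_gt0 : 0 < tau)
  (t : nat -> R) (t0 : t 0%N = 0) (tN : t N = tau)
  (t_incr : forall l : nat, (l < N)%N -> t l < t l.+1)
  (h : R) (h_def : h = mesh N t)
  (x : R -> 'cV[R]_n) (x_H1 : H1vec tau x)
  (M c : R) (M_ge0 : 0 <= M) (M_lt : M < pi / h) (c_ge0 : 0 <= c)
  (x_bound : L2norm tau (derive1 x) <= M * L2norm tau x + c)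
  (dbar : 'cV[R]_n) (dbar_gt0 : forall i : 'I_n, 0 < dbar i 0)
  (delta : nat -> 'cV[R]_n)
  (delta_le : forall (l : nat) (i : 'I_n), (l <= N)%N ->
     `|delta l i 0| <= dbar i 0)
  (xbar : R -> 'cV[R]_n) (xbar_H1 : H1vec tau xbar)
  (xbar_interp : forall (l : nat) (s : R), (l < N)%N ->
     t l <= s -> s < t l.+1 ->
     xbar s = ((t l.+1 - s) / (t l.+1 - t l)) *: (x (t l) + delta l)
            + ((s - t l) / (t l.+1 - t l)) *: (x (t l.+1) + delta l.+1))
  (xbar_tau : xbar tau = x tau + delta N)
  (sigma : R) (sigma_gt0 : 0 < sigma)
  (v : R -> 'cV[R]_n) (v_L2 : L2vec tau v)
  (V_le : loewner_le (FFadj tau (synthesis tau v)) (sigma ^+ 2)%:M) :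
  let P := synthesis tau (fun s => derive1 x s - derive1 xbar s + v s) in
  let Q := synthesis tau (fun s => x s - xbar s) in
  loewner_le (FFadj tau P)
    ((h * (M * L2norm tau xbar + c) / (pi - h * M)
      + pi * Num.sqrt tau * enorm dbar / (pi - h * M)
      + sigma) ^+ 2)%:M
  /\
  loewner_le (FFadj tau Q)
    (tau ^+ 2 / pi ^+ 2
     * (h * (M * L2norm tau xbar + c) / (pi - h * M)
        + pi * Num.sqrt tau * enorm dbar / (pi - h * M)) ^+ 2)%:M.
Proof.
move=> P Q.
have pi0 := pi_gt0 R.
have th l : (l < N)%N -> t l.+1 - t l <= h.
  by move=> lN; rewrite h_def; exact: (le_bigmax _ (fun i : 'I_N => t i.+1 - t i) (Ordinal lN)).
have h0 : 0 < h by have := th _ N_gt0; have := t_incr _ N_gt0; lra.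
have piM : 0 < pi - h * M by rewrite subr_gt0 mulrC -ltr_pdivlMr.
have Lx := H1vec_L2vec tau_gt0 x_H1.
have Lxbar := H1vec_L2vec tau_gt0 xbar_H1.
have Lx' : L2vec tau (derive1 x) by case: x_H1.
have Lxbar' : L2vec tau (derive1 xbar) by case: xbar_H1.
pose e s := x s - xbar s.
have Le : L2vec tau e := L2vecB Lx Lxbar.
(* The formula extends to the closed subinterval: its value at [t l.+1] is that of the next piece at
   its left end, or that of [xbar_tau] when [l.+1 = N]. *)
have interp l s : (l < N)%N -> t l <= s -> s <= t l.+1 ->
    xbar s = ((t l.+1 - s) / (t l.+1 - t l)) *: (x (t l) + delta l)
           + ((s - t l) / (t l.+1 - t l)) *: (x (t l.+1) + delta l.+1).
  move=> lN ls; rewrite le_eqVlt => /predU1P[->|]; last exact: xbar_interp.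
  have tl := t_incr _ lN.
  rewrite subrr mul0r scale0r add0r divff ?scale1r; last by rewrite gt_eqF// subr_gt0.
  have [lN1|] := ltnP l.+1 N; last first.
    by move=> Nl; rewrite (_ : l.+1 = N) ?tN ?xbar_tau//; apply/eqP; rewrite eqn_leq lN Nl.
  have tl1 := t_incr _ lN1.
  rewrite (xbar_interp _ _ lN1 (lexx _) tl1) subrr mul0r scale0r addr0 divff ?scale1r//.
  by rewrite gt_eqF// subr_gt0.
set S := Num.sqrt tau * enorm dbar.
have S0 : 0 <= S by rewrite mulr_ge0 ?sqrtr_ge0 ?enorm_ge0.
have S2 : S ^+ 2 = tau * edot dbar dbar.
  by rewrite exprMn sqr_enorm sqr_sqrtr// ltW.
(* The scalar estimates are summed over the coordinates for a common [s]; then [young_sqr] combines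
   the two terms. *)
have e_le : L2norm tau e <= h / pi * L2norm tau (derive1 x) + S.
  have hp0 : 0 <= h / pi by rewrite divr_ge0 ?ltW.
  have A0 : 0 <= h / pi * L2norm tau (derive1 x) := mulr_ge0 hp0 (L2norm_ge0 _ _).
  rewrite -ler_sqr ?nnegrE ?L2norm_ge0//; last exact: addr_ge0.
  apply: young_sqr => // s s0; rewrite (L2norm_sqr_sum Le) exprMn (L2norm_sqr_sum Lx') S2.
  rewrite /edot !mulr_sumr -big_split/=; apply: ler_sum => i _.
  have [acx Px sx'] := H1vec_component i tau_gt0 x_H1.
  have [acxb _ _] := H1vec_component i tau_gt0 xbar_H1.
  have := @noisy_interpolation_error R N t h s (dbar i 0) (fun l => delta l i 0)
    (fun u => x u i 0) (fun u => derive1 x u i 0) (fun u => xbar u i 0) s0 (ltW (dbar_gt0 i)) t_incr th.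
  rewrite t0 tN => /(_ acx Px sx' (ac_sqint tau_gt0 acxb) (fun l lN => delta_le l i lN)).
  have xbi l u : (l < N)%N -> t l <= u -> u <= t l.+1 ->
      xbar u i 0 = (t l.+1 - u) / (t l.+1 - t l) * (x (t l) i 0 + delta l i 0) +
           (u - t l) / (t l.+1 - t l) * (x (t l.+1) i 0 + delta l.+1 i 0).
    by move=> lN lu ul; rewrite (interp _ _ lN lu ul) !mxE.
  move=> /(_ xbi); rewrite subr0.
  rewrite [X in _ -> X <= _](@eq_Rintegral _ _ _ lebesgue_measure _
    (fun u => (x u i 0 - xbar u i 0) ^+ 2)); last first.
    by move=> u _; rewrite !mxE.
  by move=> /le_trans; apply; rewrite le_eqVlt; apply/orP; left; apply/eqP; ring.
have x_le : L2norm tau x <= L2norm tau xbar + L2norm tau e.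
  have := L2norm_triangle Lxbar Le.
  by rewrite (_ : (fun s => xbar s + e s) = x)//; apply/funext => s; rewrite /e addrC subrK.
set X := L2norm tau xbar in x_le *; set E := L2norm tau e in e_le x_le *.
set D := h * (M * X + c) / (pi - h * M) + pi * Num.sqrt tau * enorm dbar / (pi - h * M).
have E0 : 0 <= E by exact: L2norm_ge0.
have ED : E <= D.
  (* Multiplied by pi, the estimate reads [pi E <= h (M (X + E) + c) + pi S]. The term [h M E] moves
     to the left, where [pi - h M] is positive because [M < pi / h]. *)
  rewrite /D -mulrDl ler_pdivlMr//.
  have e_le' : pi * E <= h * L2norm tau (derive1 x) + pi * S.
    have := ler_wpM2l (ltW pi0) e_le.
    by rewrite mulrDr [pi * (_ * _)]mulrA [pi * (h / pi)]mulrCA divff ?mulr1// gt_eqF.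
  have : h * L2norm tau (derive1 x) <= h * (M * (X + E) + c).
    apply: ler_wpM2l; first exact: ltW.
    by apply: (le_trans x_bound); rewrite lerD2r; apply: ler_wpM2l.
  have -> : pi * Num.sqrt tau * enorm dbar = pi * S by rewrite /S mulrA.
  by move: e_le'; generalize (L2norm tau (derive1 x)) S => a b; lra.
have D0 : 0 <= D := le_trans E0 ED.
have compE i : ac 0 tau (fun s => e s i 0) /\
    primitive 0 tau (fun s => e s i 0) (fun s => (derive1 x s - derive1 xbar s) i 0).
  have [_ Px _] := H1vec_component i tau_gt0 x_H1.
  have [_ Pxb _] := H1vec_component i tau_gt0 xbar_H1.
  suff Pe : primitive 0 tau (fun s => e s i 0) (fun s => (derive1 x s - derive1 xbar s) i 0).
    by split => //; exact: primitive_ac Pe.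
  have := primitiveD Px (primitiveZ (-1) Pxb).
  congr primitive; apply/funext => s; by rewrite !mxE mulN1r.
have Le' : L2vec tau (fun s => derive1 x s - derive1 xbar s) := L2vecB Lx' Lxbar'.
have LP : L2vec tau (fun s => derive1 x s - derive1 xbar s + v s) := L2vecD Le' v_L2.
split.
  apply: loewner_le_of_bound.
  - exact: synthesis_adjointP.
  - by rewrite addr_ge0// ltW.
  move=> phi y Hphi.
  have [aphi _ _ _ _] := H10_primitive tau_gt0 Hphi.
  have sphi := ac_sqint tau_gt0 aphi.
  have mI : measurable (`[0, tau] : set (measurableTypeR R)) by exact: measurable_itv.
  (* [P] splits into the operator of the error derivative, bounded by [E <= D], and [V], bounded by
     [sigma]. *)
  have -> : edot (P phi) y = edot (synthesis tau (fun s => derive1 x s - derive1 xbar s) phi) y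
      + edot (synthesis tau v phi) y.
    rewrite !(edot_synthesis _ _ sphi)//.
    rewrite -(RintegralD mI (sqintM sphi (L2vec_edot_sqint y Le')) (sqintM sphi (L2vec_edot_sqint y v_L2))).
    by apply: eq_Rintegral => s _; rewrite edotDl mulrDr.
  have b1 := synthesis_derive_bound y tau_gt0 Le Le' (fun i => (compE i).1) (fun i => (compE i).2) Hphi.
  have b2 := bound_of_loewner_le (synthesis_adjointP tau_gt0 v_L2) tau_gt0 (ltW sigma_gt0) V_le y Hphi.
  apply: (le_trans (lerD b1 b2)); rewrite -!mulrA -mulrDl; apply: ler_wpM2r.
    by rewrite mulr_ge0 ?enorm_ge0 ?sqrtr_ge0.
  by rewrite lerD2r.
(* The constant becomes the square of [tau / pi * D], the form in which an operator bound yields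
   it. *)
rewrite -[tau ^+ 2 / pi ^+ 2]expr_div_n -exprMn.
have tp0 : 0 <= tau / pi by rewrite divr_ge0 ?ltW.
apply: loewner_le_of_bound.
- exact: synthesis_adjointP.
- by rewrite mulr_ge0.
move=> phi y Hphi; apply: (le_trans (synthesis_bound y tau_gt0 Le Hphi)).
do 2 (apply: ler_wpM2r; first by rewrite ?enorm_ge0 ?sqrtr_ge0).
exact: ler_wpM2l.
Qed.
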